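(* For $n\ge 3$ and $m\ge 0$, $$\operatorname{depth}\left(\frac{R_{n,m}}{I(G_{n,m})}\right)=\begin{cases}\operatorname{depth}\left(\dfrac{A_n}{I(C_n)}\right)+\dfrac{m}{3}=\left\lceil\dfrac{n-1}{3}\right\rceil+\dfrac{m}{3}, & \text{if } m\equiv 0 \bmod 3,\\[2mm] \left\lceil\dfrac{n}{3}\right\rceil+\dfrac{m-1}{3}, & \text{if } m\equiv 1\bmod 3,\\[2mm] \operatorname{depth}\left(\dfrac{A_n}{I(C_n)}\right)+\dfrac{m+1}{3}=\left\lceil\dfrac{n-1}{3}\right\rceil+\dfrac{m+1}{3}, & \text{if } m\equiv 2\bmod 3.\end{cases}$$
   Context: Let $k$ be a field, $A_n=k[x_1,\ldots,x_n]$, and $R_{n,m}=k[x_1,\ldots,x_n,y_1,\ldots,y_m]$ (so $R_{n,0}=A_n$). $C_n$ is the cycle on $x_1,\ldots,x_n$, with edge ideal $I(C_n)=(x_1x_2,x_2x_3,\ldots,x_{n-1}x_n,x_1x_n)$; $P_m$ is the path on $y_1,\ldots,y_m$, with edge ideal $I(P_m)=(y_1y_2,\ldots,y_{m-1}y_m)$. For $m\ge 2$, $G_{n,m}$ is the graph whose edge ideal in $R_{n,m}$ is $I(G_{n,m})=(I(C_n),x_2y_1,I(P_m))$; by convention $I(G_{n,0})=I(C_n)$ and $I(G_{n,1})=(I(C_n),x_2y_1)$. Depth is taken with respect to the homogeneous maximal ideal (generated by all the variables). *)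

(* Defs.v *)
From HB Require Import structures.
From Stdlib Require Import ClassicalEpsilon.
From mathcomp Require Import all_boot all_order all_algebra.
From mathcomp Require Export mpoly.

Set Implicit Arguments.
Unset Strict Implicit.
Unset Printing Implicit Defensive.

Import GRing.Theory.
Local Open Scope ring_scope.

Definition ceil_div (a b : nat) : nat := (a %/ b + (a %% b != 0))%N.

Section Depth.
Variable R : comNzRingType.
Implicit Types a s fs : seq R.

(* Ideals are given by finite lists of generators; [s ++ t] generates the sum
   of the ideals generated by [s] and [t]. *)
Definition in_ideal s (f : R) : Prop :=
  exists c : 'I_(size s) -> R, f = \sum_(i < size s) c i * s`_i.

(* [fs] is a regular sequence on the R-module M = R / (s).  Since
   M / (f_0, ..., f_(i-1)) M = R / (s, f_0, ..., f_(i-1)), multiplication by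
   f_i on this quotient is injective exactly when f_i * g in the ideal
   (s, f_0, ..., f_(i-1)) forces g into it; the second clause is M <> (fs) M. *)
Definition regular_seq s fs : Prop :=
  (forall i, (i < size fs)%N -> forall g : R,
     in_ideal (s ++ take i fs) (fs`_i * g) -> in_ideal (s ++ take i fs) g)
  /\ ~ in_ideal (s ++ fs) 1.

Definition regular_seq_in a s fs : Prop :=
  (forall f, f \in fs -> in_ideal a f) /\ regular_seq s fs.

Definition is_depth a s (d : nat) : Prop :=
  (exists2 fs, regular_seq_in a s fs & size fs = d) /\
  (forall fs, regular_seq_in a s fs -> (size fs <= d)%N).

(* The depth of R / (s) with respect to the ideal (a).  The value 0 is a
   convention for the case where regular sequences in (a) on R / (s) have no
   maximal length (or do not exist at all, when R / (s) = 0). *)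
Definition depth a s : nat :=
  match excluded_middle_informative (exists d, is_depth a s d) with
  | left h => proj1_sig (constructive_indefinite_description _ h)
  | right _ => 0%N
  end.

Lemma is_depth_inj a s d e : is_depth a s d -> is_depth a s e -> d = e.
Proof.
move=> [[fs rfs <-] maxd] [[gs rgs <-] maxe].
by apply/eqP; rewrite eqn_leq maxe // maxd.
Qed.

Lemma depthE a s d : is_depth a s d -> depth a s = d.
Proof.
rewrite /depth => hd; case: excluded_middle_informative => [h|[]]; last first.
  by exists d.
case: constructive_indefinite_description => e he /=.
exact: is_depth_inj he hd.
Qed.

Lemma depth_gt0_is_depth a s : (0 < depth a s)%N -> is_depth a s (depth a s).
Proof.
rewrite /depth; case: excluded_middle_informative => // h _.
by case: constructive_indefinite_description.
Qed.

(* Generators of the edge ideals of the cycle on x_1, ..., x_n and of the path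
   on y_1, ..., y_m, the variables being indexed from 0; [ordS] is the cyclic
   successor, so that the last generator of the cycle is x_n x_1. *)
Definition cycle_gens n (x : 'I_n -> R) : seq R :=
  [seq x i * x (ordS i) | i <- enum 'I_n].

Definition path_gens m (y : 'I_m -> R) : seq R :=
  [seq y p.1 * y p.2 | p : 'I_m * 'I_m <- enum {: 'I_m * 'I_m} & val p.2 == (val p.1).+1].

(* The single generator x_2 y_1 (none if m = 0). *)
Definition link_gens n m (x : 'I_n -> R) (y : 'I_m -> R) : seq R :=
  [seq x p.1 * y p.2 | p : 'I_n * 'I_m <- enum {: 'I_n * 'I_m}
     & (val p.1 == 1%N) && (val p.2 == 0%N)].

End Depth.

Section EdgeIdeals.
Variable k : fieldType.

(* The ring R_{n,m} is {mpoly k[n + m]}, with x_1, ..., x_n the first n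
   variables and y_1, ..., y_m the last m ones. *)
Definition xvar n m (i : 'I_n) : {mpoly k[n + m]} := 'X_(lshift m i).
Definition yvar n m (j : 'I_m) : {mpoly k[n + m]} := 'X_(rshift n j).

Definition max_ideal N : seq {mpoly k[N]} := [seq 'X_i | i <- enum 'I_N].

Definition I_C n : seq {mpoly k[n]} := cycle_gens (fun i : 'I_n => 'X_i).

Definition I_G n m : seq {mpoly k[n + m]} :=
  cycle_gens (@xvar n m) ++ link_gens (@xvar n m) (@yvar n m)
  ++ path_gens (@yvar n m).

End EdgeIdeals.

(* Main.v *)
From HB Require Import structures.
Require Import Defs.
From mathcomp Require Import all_boot all_order all_algebra.
From mathcomp Require Import mpoly zify ring.

Set Implicit Arguments.
Unset Strict Implicit.
Unset Printing Implicit Defensive.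

Import GRing.Theory.

(** Both depths are read off from the graph, because an edge ideal is the ideal
of the polynomials without monomials supported on independent sets. The depth
is bounded from both sides by means that work over every field.

Below: the elementary symmetric polynomials e_1, ..., e_d in all the variables
form a regular sequence modulo the variables outside W as soon as W has at
least d elements (lemma [simplex_weakly_regular]). A sequence that is regular
on both ends of 0 -> S/(J : x) -> S/J -> S/(J + x) -> 0 is regular in the middle
([weakly_regular_branch]). For an edge ideal and a vertex v, the two ends are
the edge ideals of the graph with the neighbours of v removed and with v
removed, so branching on vertices down to edgeless graphs shows that one and
the same sequence is regular on S/I; d may be the least number of vertices of
a leaf ([branch_bound_regular]). For the cycle with a tail one branches at
x_2: what remains consists of paths, each of which contributes a third of its
length, rounded up ([path_branch_bound]).

Above: let H be the Koszul cohomology of S/J for the squares of the variables.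
If f starts a regular sequence in the maximal ideal, then f acts injectively on
the low degrees of H by induction on the length of the sequence, and
nilpotently since a power of f lies in the ideal of the squares; hence H
vanishes below the length of the sequence ([weakly_regular_koszul_exact]), and
a nonzero class in degree d bounds the depth by d. As in Hochster's formula,
classes come from the reduced cohomology of links of faces Y of the
independence complex, times the monomial of Y ([not_koszul_exact]); taking
squares rather than the variables themselves is what leaves room for that
monomial. A maximal independent set Y, whose link is the empty sphere, gives a
class in degree #|Y|.

This suffices except when n = 3k+1 and 3 divides m; already for the 4-cycle all
maximal independent sets have two elements while the depth is one. In that
case Y is a maximal independent set of the tail avoiding y_1, whose link
is the independence complex of the cycle, homotopy equivalent to a sphere of
dimension k-1. Its top class is an explicit cocycle, a staircase of k+1 faces
([stair_cocycle]), and it is nonzero because it pairs to a sign with the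
boundary of the cross-polytope spanned by k disjoint edges of the cycle
([cycle_class]). *)

(** * Ideals and regular sequences *)

Section Ideals.
Local Open Scope ring_scope.
Variable R : comNzRingType.
Implicit Types (J K : R -> Prop) (f g h : R) (s fs : seq R).

(** Ideals are predicates rather than lists of generators, so that colon ideals
and the ideals of nonfaces below are treated on the same footing. *)
Definition is_ideal J :=
  [/\ J 0, forall f g, J f -> J g -> J (f + g) & forall f g, J g -> J (f * g)].

(** The ideal J + (f). *)
Definition ideal_adj J f : R -> Prop := fun g => exists h, J (g - f * h).

Definition ideal_colon J f : R -> Prop := fun g => J (f * g).

Definition nzd J f := forall g, J (f * g) -> J g.

(** The quotient by the whole sequence may vanish: this keeps the notion stable
under passing to colon ideals, which can be the unit ideal. *)
Fixpoint weakly_regular J fs : Prop :=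
  if fs is f :: fs' then
    nzd J f /\ weakly_regular (ideal_adj J f) fs'
  else True.

Section OneIdeal.
Variable J : R -> Prop.
Hypothesis idJ : is_ideal J.

Lemma idl0 : J 0. Proof. by case: idJ. Qed.
Lemma idlD f g : J f -> J g -> J (f + g). Proof. by case: idJ => _ + _; apply. Qed.
Lemma idlMl f g : J g -> J (f * g). Proof. by case: idJ => _ _; apply. Qed.
Lemma idlMr f g : J f -> J (f * g). Proof. by rewrite mulrC; apply: idlMl. Qed.
Lemma idlN f : J f -> J (- f).
Proof. by move=> Jf; rewrite -mulN1r; apply: idlMl. Qed.
Lemma idlB f g : J f -> J g -> J (f - g).
Proof. by move=> Jf Jg; apply: idlD => //; apply: idlN. Qed.
Lemma idl_sum I (r : seq I) (P : pred I) (F : I -> R) :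
  (forall i, P i -> J (F i)) -> J (\sum_(i <- r | P i) F i).
Proof. by move=> H; apply: big_ind => //; [apply: idl0 | apply: idlD]. Qed.

Lemma idl_subr f g : J (f - g) -> J g -> J f.
Proof. by move=> H Jg; rewrite -(subrK g f); apply: idlD. Qed.

Lemma ideal_adj_is_ideal f : is_ideal (ideal_adj J f).
Proof.
split.
- by exists 0; rewrite mulr0 subr0; apply: idl0.
- move=> g h [g' Jg] [h' Jh]; exists (g' + h').
  have -> : g + h - f * (g' + h') = (g - f * g') + (h - f * h') by ring.
  exact: idlD.
- move=> g h [h' Jh]; exists (g * h').
  have -> : g * h - f * (g * h') = g * (h - f * h') by ring.
  exact: idlMl.
Qed.

Lemma ideal_adj_sub f g : J g -> ideal_adj J f g.
Proof. by exists 0; rewrite mulr0 subr0. Qed.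

Lemma ideal_adj_mul f g : ideal_adj J f (f * g).
Proof. by exists g; rewrite subrr; apply: idl0. Qed.

End OneIdeal.

Lemma eq_ideal_adj J K f : (forall g, J g <-> K g) ->
  forall g, ideal_adj J f g <-> ideal_adj K f g.
Proof. by move=> JK g; split=> -[h] /JK; exists h. Qed.

Lemma eq_weakly_regular fs J K : (forall g, J g <-> K g) -> weakly_regular J fs ->
  weakly_regular K fs.
Proof.
elim: fs J K => //= f fs IH J K JK [Jf Jfs]; split; last first.
  by apply: IH Jfs => g; apply: eq_ideal_adj.
by move=> g /JK/Jf/JK.
Qed.

Lemma ideal_adjC J f g h :
  ideal_adj (ideal_adj J f) g h <-> ideal_adj (ideal_adj J g) f h.
Proof.
by split=> -[a [b H]]; exists b, a; rewrite addrAC.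
Qed.

(** Exactness of 0 -> S/(J : x) -> S/J -> S/(J + x) -> 0: a nonzerodivisor on the
ends is one in the middle, and by the snake lemma the sequence of quotients by
it is again exact, which is what keeps the induction going. *)
Lemma weakly_regular_branch J x fs : is_ideal J ->
  weakly_regular (ideal_colon J x) fs -> weakly_regular (ideal_adj J x) fs ->
    weakly_regular J fs.
Proof.
elim: fs J => //= f fs IH J idJ [colf colfs] [adjf adjfs]; split.
  move=> g Jfg.
  have [h Jh] : ideal_adj J x g by apply: adjf; exact: ideal_adj_sub.
  apply: (idl_subr idJ Jh); apply: (colf h); rewrite /ideal_colon.
  have -> : x * (f * h) = f * g - f * (g - x * h) by ring.
  by apply: (idlB idJ) => //; apply: idlMl.
apply: IH; first exact: ideal_adj_is_ideal.
- apply: eq_weakly_regular colfs => g; split=> -[h]; rewrite /ideal_colon => Jh.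
    exists (x * h).
    by have -> : x * g - f * (x * h) = x * (g - f * h) by ring.
  have [a Ja] : ideal_adj J x h.
    apply: adjf; exists g.
    have -> : f * h - x * g = - (x * g - f * h) by ring.
    exact: idlN.
  exists a; rewrite /ideal_colon.
  have -> : x * (g - f * a) = (x * g - f * h) + f * (h - x * a) by ring.
  by apply: (idlD idJ) => //; apply: idlMl.
- by apply: eq_weakly_regular adjfs => g; apply: ideal_adjC.
Qed.

Lemma in_ideal_is_ideal s : is_ideal (in_ideal s).
Proof.
split.
- by exists (fun=> 0); rewrite big1 // => i _; rewrite mul0r.
- move=> f g [c ->] [d ->]; exists (fun i => c i + d i).
  by rewrite -big_split; apply: eq_bigr => i _; rewrite mulrDl.
- move=> f g [c ->]; exists (fun i => f * c i).
  by rewrite mulr_sumr; apply: eq_bigr => i _; rewrite mulrA.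
Qed.

Lemma in_ideal_gen s f : f \in s -> in_ideal s f.
Proof.
move=> fs; have ltf : (index f s < size s)%N by rewrite index_mem.
exists (fun i => (i == Ordinal ltf)%:R).
rewrite (bigD1 (Ordinal ltf)) //= eqxx mul1r nth_index // big1 ?addr0 //.
by move=> i /negPf->; rewrite mul0r.
Qed.

Lemma in_ideal_min s J : is_ideal J -> (forall f, f \in s -> J f) ->
  forall f, in_ideal s f -> J f.
Proof.
move=> idJ sJ f [c ->]; apply: (idl_sum idJ) => i _.
by apply: (idlMl idJ); apply/sJ/mem_nth.
Qed.

Lemma in_ideal_rcons s f g : in_ideal (rcons s f) g <-> ideal_adj (in_ideal s) f g.
Proof.
split.
  move: g; apply: in_ideal_min; first exact/ideal_adj_is_ideal/in_ideal_is_ideal.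
  move=> g; rewrite mem_rcons inE => /predU1P[->|gs].
    rewrite -[X in ideal_adj _ _ X]mulr1; exact/ideal_adj_mul/in_ideal_is_ideal.
  exact/ideal_adj_sub/in_ideal_gen.
case=> h sh; have idr := in_ideal_is_ideal (rcons s f).
have sub a : a \in s -> in_ideal (rcons s f) a.
  by move=> sa; apply: in_ideal_gen; rewrite mem_rcons inE sa orbT.
apply: (idl_subr idr (g := f * h)); first exact: in_ideal_min sh.
by apply: (idlMr idr); apply: in_ideal_gen; rewrite mem_rcons inE eqxx.
Qed.

Lemma weakly_regular_in_ideal s fs : weakly_regular (in_ideal s) fs <->
  forall i, (i < size fs)%N -> forall g : R,
     in_ideal (s ++ take i fs) (fs`_i * g) -> in_ideal (s ++ take i fs) g.
Proof.
elim: fs s => [|f fs IH] s //=; split.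
- case=> Hf Hfs [_ g|i]; first by rewrite !cats0; apply: Hf.
  rewrite ltnS -cat_rcons /=; apply: ((IH _).1 _ i).
  by apply: eq_weakly_regular Hfs => g; rewrite in_ideal_rcons.
- move=> H; split; first by move=> g; have := H 0%N isT g; rewrite cats0.
  have/IH : forall i, (i < size fs)%N -> forall g : R,
     in_ideal (rcons s f ++ take i fs) (fs`_i * g) ->
       in_ideal (rcons s f ++ take i fs) g.
    by move=> i lti g; have := H i.+1 lti g; rewrite /= cat_rcons.
  by apply: eq_weakly_regular => g; rewrite in_ideal_rcons.
Qed.

End Ideals.

(** * Koszul cohomology and the length of regular sequences *)

Section Koszul.
Local Open Scope ring_scope.
Variables (R : comNzRingType) (N : nat) (a : 'I_N -> R).
Implicit Types (A B : {set 'I_N}) (c : {set 'I_N} -> R) (J : R -> Prop).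

(** The exponent of the sign with which v enters the differential at A. *)
Definition ord_pos (v : 'I_N) A : nat := #|[set u in A | (u < v)%N]|.

Lemma ord_posD1 v u A : ord_pos v A = ((u \in A) && (u < v) + ord_pos v (A :\ u))%N.
Proof.
rewrite /ord_pos (cardsD1 u) inE; congr (_ + #|pred_of_set _|)%N.
by apply/setP=> w; rewrite !inE andbA.
Qed.

Definition koszul c A : R := \sum_(v in A) (-1) ^+ ord_pos v A * (a v * c (A :\ v)).

(** Contraction by the u-th basis vector of the exterior algebra. *)
Definition koszul_htpy u c A : R :=
  if u \in A then 0 else (-1) ^+ ord_pos u A * c (u |: A).

Lemma koszulZ f c A : koszul (fun B => f * c B) A = f * koszul c A.
Proof. by rewrite mulr_sumr; apply: eq_bigr => v _ /=; ring. Qed.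

Lemma koszulB c c' A : koszul (fun B => c B - c' B) A = koszul c A - koszul c' A.
Proof. by rewrite -sumrB; apply: eq_bigr => v _ /=; ring. Qed.

Lemma ord_pos_swap u v A : u \in A -> v \in A -> u != v ->
  (-1) ^+ ord_pos u A * (-1) ^+ ord_pos v (A :\ u) =
  - ((-1) ^+ ord_pos v A * (-1) ^+ ord_pos u (A :\ v)) :> R.
Proof.
move=> uA vA uv; rewrite (ord_posD1 u v A) (ord_posD1 v u A) uA vA /=.
have : ((v < u) (+) (u < v))%N by move: uv; rewrite -val_eqE /=; case: ltngtP.
by rewrite !exprD; case: (v < u)%N; case: (u < v)%N => //= _; rewrite expr0 expr1; ring.
Qed.

Lemma ord_pos_ins u v A : u \notin A -> v \in A ->
  (-1) ^+ ord_pos v A * (-1) ^+ ord_pos u (A :\ v) =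
  - ((-1) ^+ ord_pos u A * (-1) ^+ ord_pos v (u |: A)) :> R.
Proof.
move=> uA vA; have uv : u != v by apply: contraNneq uA => ->.
rewrite (ord_posD1 u v A) (ord_posD1 v u (u |: A)) !inE eqxx vA setU1K //=.
have : ((v < u) (+) (u < v))%N by move: uv; rewrite -val_eqE /=; case: ltngtP.
by rewrite !exprD; case: (v < u)%N; case: (u < v)%N => //= _; rewrite expr0 expr1; ring.
Qed.

(** The terms indexed by (u, v) and (v, u) are opposite; pairing them, rather
than halving an antisymmetric sum, covers characteristic two. *)
Lemma koszul_koszul c A : koszul (koszul c) A = 0.
Proof.
pose F u v := (-1) ^+ ord_pos u A * (-1) ^+ ord_pos v (A :\ u) *
              (a u * a v * c (A :\ u :\ v)).
have FN u v : u \in A -> v \in A -> u != v -> F u v = - F v u.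
  move=> uA vA uv; rewrite /F ord_pos_swap // setDDl setUC -setDDl; ring.
rewrite /koszul.
transitivity (\sum_(u in A) \sum_(v in A | v != u) F u v).
  apply: eq_bigr => u uA; rewrite !mulr_sumr.
  by apply: eq_big => [v|v _]; [rewrite !inE andbC | rewrite /F; ring].
transitivity (\sum_(u in A) (\sum_(v in A | (v < u)%N) F u v
   + \sum_(v in A | (u < v)%N) F u v)).
  apply: eq_bigr => u uA; rewrite (bigID (fun v : 'I_N => (v < u)%N)) /=.
  by congr (_ + _); apply: eq_bigl => v; rewrite -val_eqE /= -andbA; congr (_ && _);
    lia.
rewrite big_split /=.
have -> : \sum_(u in A) \sum_(v in A | (u < v)%N) F u v =
          \sum_(u in A) \sum_(v in A | (v < u)%N) F v u.
  rewrite (exchange_big_dep (mem A)) /=; last by move=> ? ? _ /andP[].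
  by apply: eq_bigr => u uA; apply: eq_bigl => v; rewrite uA.
rewrite -big_split big1 // => u uA /=.
rewrite -big_split big1 // => v /andP[vA vu] /=; rewrite FN ?addNr //.
by rewrite -val_eqE /=; lia.
Qed.

(** Multiplication by each entry of the sequence is null-homotopic, hence zero
on cohomology. *)
Lemma koszul_htpyP u c A :
  koszul (koszul_htpy u c) A + koszul_htpy u (koszul c) A = a u * c A.
Proof.
rewrite /koszul; case: (boolP (u \in A)) => uA.
  rewrite {2}/koszul_htpy uA addr0 (bigD1 u) //= big1 => [|v /andP[vA vu]].
    rewrite /koszul_htpy !inE eqxx /= setD1K // addr0.
    by rewrite (ord_posD1 u u) ltnn andbF add0n mulrCA signrMK.
  by rewrite /koszul_htpy !inE uA eq_sym vu !mulr0.
rewrite {2}/koszul_htpy (negPf uA) big_setU1 //= setU1K //.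
rewrite (ord_posD1 u u (u |: A)) ltnn andbF add0n setU1K //.
rewrite mulrDr addrCA signrMK mulr_sumr -big_split big1 ?addr0 //.
move=> v vA /=; have uv : u != v by apply: contraNneq uA => ->.
rewrite /koszul_htpy !inE (negPf uA) andbF.
have -> : u |: A :\ v = (u |: A) :\ v.
  by apply/setP=> w; rewrite !inE; case: (w =P u) => [->|_]; rewrite ?uv //=.
transitivity (((-1) ^+ ord_pos v A * (-1) ^+ ord_pos u (A :\ v) +
  (-1) ^+ ord_pos u A * (-1) ^+ ord_pos v (u |: A)) * (a v * c ((u |: A) :\ v))).
  by ring.
by rewrite ord_pos_ins // addNr mul0r.
Qed.

Lemma koszul_sum I (r : seq I) (F : I -> {set 'I_N} -> R) A :
  koszul (fun B : {set 'I_N} => \sum_(i <- r) F i B) A = \sum_(i <- r) koszul (F i) A.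
Proof.
rewrite /koszul exchange_big /=; apply: eq_bigr => v _.
by rewrite !mulr_sumr.
Qed.

(** Vanishing of the i-th cohomology of the Koszul complex with coefficients in
S/J. Cochains of all degrees live on one type: in degree i only the values on
sets of size i matter. *)
Definition koszul_exact J i := forall c,
  (forall A, #|A| = i.+1 -> J (koszul c A)) ->
  exists b, forall A, #|A| = i -> J (c A - koszul b A).

Lemma koszul_ideal J i c A : is_ideal J -> (forall B, #|B| = i -> J (c B)) ->
  #|A| = i.+1 -> J (koszul c A).
Proof.
move=> idJ Jc cA; apply: (idl_sum idJ) => v vA.
do 2!apply: (idlMl idJ); apply: Jc.
by move: cA; rewrite (cardsD1 v) vA => -[].
Qed.

Lemma koszul_span J i c (g : 'I_N -> R) : is_ideal J ->
  (forall A, #|A| = i.+1 -> J (koszul c A)) ->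
  exists b, forall A, #|A| = i -> J ((\sum_v g v * a v) * c A - koszul b A).
Proof.
move=> idJ Jc; exists (fun B : {set 'I_N} => \sum_v g v * koszul_htpy v c B) => A cA.
rewrite koszul_sum mulr_suml -sumrB; apply: (idl_sum idJ) => v _.
rewrite koszulZ -mulrA -koszul_htpyP mulrDr addrC addKr.
apply: (idlMl idJ); rewrite /koszul_htpy; case: ifPn => vA; first exact: idl0.
by apply: (idlMl idJ); apply: Jc; rewrite cardsU1 vA cA.
Qed.

(** Injectivity of f on the i-th cohomology of S/J, by the long exact sequence of
0 -> S/J -> S/J -> S/(J + f) -> 0: if f c is the coboundary of b, then b is a
cocycle modulo J + f, hence a coboundary there, and correcting b by it makes
b divisible by f. *)
Lemma koszul_cancel J f i c b : is_ideal J ->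
  nzd J f ->
  (forall j, i = j.+1 -> koszul_exact (ideal_adj J f) j) ->
  (forall A, #|A| = i -> J (f * c A - koszul b A)) ->
  exists h, forall A, #|A| = i -> J (c A - koszul h A).
Proof.
move=> idJ nzf exJ Jb; case: i => [|i] in exJ Jb *.
  exists (fun=> 0) => A cA; have A0 : A = set0 by apply: cards0_eq.
  move: (Jb A cA); rewrite A0 /koszul !big_set0 !subr0; exact: nzf.
have [b' Jb'] : exists b', forall A, #|A| = i -> ideal_adj J f (b A - koszul b' A).
  apply: (exJ i erefl) => A cA; exists (c A).
  by rewrite -[X in J X]opprB; apply: (idlN idJ); apply: Jb.
have [h Jh] : exists h : {set 'I_N} -> R,
    forall A, #|A| = i -> J (b A - koszul b' A - f * h A).
  apply: (@fin_all_exists {set 'I_N} (fun=> R)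
      (fun A x => #|A| = i -> J (b A - koszul b' A - f * x))) => A.
  case: (#|A| =P i) => [cA|ncA]; last by exists 0.
  by have [x Jx] := Jb' A cA; exists x.
exists h => A cA; apply: nzf.
have := koszul_ideal idJ Jh cA.
rewrite koszulB koszulB koszulZ koszul_koszul subr0 => Jk; rewrite mulrBr.
have -> : f * c A - f * koszul h A =
    (f * c A - koszul b A) + (koszul b A - f * koszul h A) by ring.
by apply: (idlD idJ) => //; apply: Jb.
Qed.

(** The first entry of the sequence is both injective and nilpotent on the
cohomology in question. *)
Theorem weakly_regular_koszul_exact J fs : is_ideal J -> weakly_regular J fs ->
  (forall f, f \in fs -> exists p (g : 'I_N -> R), f ^+ p = \sum_v g v * a v) ->
  forall i, (i < size fs)%N -> koszul_exact J i.
Proof.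
elim: fs J => [|f fs IH] J idJ //= [nzf regfs] nil i ltif c Jc.
have exJ j : i = j.+1 -> koszul_exact (ideal_adj J f) j.
  move=> ij; apply: IH => //; first exact: ideal_adj_is_ideal.
    by move=> h hfs; apply: nil; rewrite inE hfs orbT.
  by rewrite -ltnS -ij.
have [p [g fp]] := nil f (mem_head _ _).
have := koszul_span g idJ Jc; rewrite -fp.
elim: p {fp} c {Jc} => [|p IHp] c [b Jb].
  by exists b => A cA; rewrite -[X in X - _]mul1r; apply: Jb.
have [h Jh] : exists h, forall A, #|A| = i -> J (f ^+ p * c A - koszul h A).
  apply: (koszul_cancel idJ nzf exJ (c := fun A => f ^+ p * c A) (b := b)) => A cA.
  by rewrite mulrA -exprS; apply: Jb.
by apply: IHp; exists h.
Qed.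

End Koszul.

(** * Ideals of nonfaces *)

Section NonFace.
Local Open Scope ring_scope.
Variables (k : fieldType) (N : nat).
Local Notation S := {mpoly k[N]}.
Implicit Types (A B W : {set 'I_N}) (D : {set 'I_N} -> bool) (m : 'X_{1..N}) (g h : S).

Definition msupport m : {set 'I_N} := [set i | m i != 0%N].

Lemma msupportD m1 m2 : msupport (m1 + m2) = msupport m1 :|: msupport m2.
Proof. by apply/setP=> i; rewrite !inE mnmDE addn_eq0 negb_and. Qed.

Lemma msupport1 v : msupport U_(v) = [set v].
Proof. by apply/setP=> i; rewrite !inE mnm1E eqb0 negbK eq_sym. Qed.

(** The Stanley-Reisner ideal of D, given by a condition on coefficients: sums,
colons and quotients by variables then never involve monomial generators. *)
Definition nonface_ideal D : S -> Prop := fun g => forall m, D (msupport m) -> g@_m = 0.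

Definition downclosed D := forall A B, A \subset B -> D B -> D A.

Lemma mcoeffM0 g h m :
  (forall m1 m2, m = (m1 + m2)%MM -> g@_m1 * h@_m2 = 0) -> (g * h)@_m = 0.
Proof. by move=> gh; rewrite mcoeffM big1 // => -[m1 m2] /= /eqP; apply: gh. Qed.

Lemma nonface_ideal_is_ideal D : downclosed D -> is_ideal (nonface_ideal D).
Proof.
move=> dD; split=> [m _|g h Jg Jh m Dm|g h Jh m Dm].
- by rewrite mcoeff0.
- by rewrite mcoeffD Jg ?Jh ?addr0.
- apply: mcoeffM0 => m1 m2 mE.
  rewrite Jh ?mulr0 //; apply: dD Dm; rewrite mE msupportD; exact: subsetUr.
Qed.

Lemma nonface_idealX D m : ~~ D (msupport m) -> nonface_ideal D 'X_[m].
Proof. by move=> nDm m' Dm'; rewrite mcoeffX; case: eqP => // E;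
  rewrite -E (negPf nDm) in Dm'. Qed.

Lemma mcoeffXM g v m : m v != 0%N -> ('X_v * g)@_m = g@_(m - U_(v)).
Proof.
move=> mv; have le : (U_(v) <= m)%MM by apply/mnm_lepP=> i; rewrite mnm1E;
  case: eqP => // <-; rewrite lt0n.
by rewrite -[in LHS](submK le) addmC mulrC mcoeffMX.
Qed.

Lemma mcoeffXM0 g v m : m v = 0%N -> ('X_v * g)@_m = 0.
Proof.
move=> mv; apply: mcoeffM0 => m1 m2 mE.
rewrite mcoeffX; case: eqP => [E|]; last by rewrite mul0r.
by move/mnmP/(_ v): mE; rewrite mv mnmDE -E mnm1E eqxx.
Qed.

(** These are the faces of the star of v. *)
Lemma nonface_colon D v : downclosed D -> forall g,
  nonface_ideal (fun A => D (v |: A)) g <-> ideal_colon (nonface_ideal D) 'X_v g.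
Proof.
move=> dD g; split=> Jg m Dm.
  have [mv|mv] := eqVneq (m v) 0%N; first exact: mcoeffXM0.
  rewrite mcoeffXM // Jg //; apply: dD Dm; rewrite subUset sub1set inE mv /=.
  by apply/subsetP=> i; rewrite !inE mnmBE; apply: contraNneq => ->.
have := Jg (U_(v) + m)%MM; rewrite mulrC mcoeffMX; apply.
by rewrite msupportD msupport1.
Qed.

(** These are the faces of the deletion of v: every monomial divisible by x_v can
be absorbed in the multiple of x_v. *)
Lemma nonface_adj D v : downclosed D -> forall g,
  nonface_ideal (fun A => (v \notin A) && D A) g
    <-> ideal_adj (nonface_ideal D) 'X_v g.
Proof.
move=> dD g; split.
  move=> Jg.
  exists (\sum_(m <- msupp g | m v != 0%N) g@_m *: 'X_[m - U_(v)]) => m Dm.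
  suff -> : g - 'X_v * (\sum_(m <- msupp g | m v != 0%N) g@_m *: 'X_[m - U_(v)])
      = \sum_(m <- msupp g | m v == 0%N) g@_m *: 'X_[m].
    rewrite raddf_sum big1 //= => m' m'v; rewrite mcoeffZ mcoeffX.
    case: eqP => [E|]; last by rewrite mulr0.
    by rewrite mulr1 Jg // inE m'v /= E.
  rewrite {1}[g]mpolyE (bigID (fun m : 'X_{1..N} => m v == 0%N)) /= -addrA mulr_sumr.
  rewrite -sumrB [X in _ + X]big1 ?addr0 // => m' m'v.
  rewrite -scalerAr -mpolyXD addmC submK ?subrr //.
  by apply/mnm_lepP=> i; rewrite mnm1E; case: eqP => // <-; rewrite lt0n.
case=> h Jh m; rewrite inE negbK => /andP[/eqP mv Dm].
by have := Jh m Dm; rewrite mcoeffB mcoeffXM0 // subr0.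
Qed.

(** The coaction of the degree grading: the substitution of t x_i for x_i, so that
the coefficient of t^d in the image of g is the component of degree d. As a
ring morphism it handles products of homogeneous polynomials without any
convolution of components. *)
Definition grading : S -> {poly S} :=
  mmap (polyC \o @mpolyC N k) (fun i => 'X_i *: 'X).

HB.instance Definition _ := GRing.RMorphism.copy grading
  (mmap (polyC \o @mpolyC N k) (fun i => 'X_i *: 'X)).

Lemma gradingE g : grading g = \sum_(m <- msupp g) (g@_m *: 'X_[m]) *: 'X^(mdeg m).
Proof.
apply: eq_bigr => m _ /=; rewrite mul_polyC -mul_mpolyC -scalerA; congr (_ *: _).
rewrite /mmap1 mpolyXE_id mdegE.
rewrite -prodrXr -scaler_prod; apply: eq_bigr => i _.
by rewrite exprZn.
Qed.

Lemma grading_X m : grading 'X_[m] = 'X_[m] *: 'X^(mdeg m).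
Proof. by rewrite gradingE msuppX big_seq1 mcoeffX eqxx scale1r. Qed.

Lemma grading1 g : (grading g).[1] = g.
Proof.
rewrite gradingE horner_sum [RHS]mpolyE; apply: eq_bigr => m _.
by rewrite hornerZ hornerXn expr1n mulr1.
Qed.

Definition homog_ideal (J : S -> Prop) := forall g, J g -> forall d, J (grading g)`_d.

Lemma nonface_homog D : homog_ideal (nonface_ideal D).
Proof.
move=> g Jg d m Dm; rewrite gradingE coef_sum raddf_sum big1 //= => m' _.
rewrite coefZ coefXn; case: eqP => _; last by rewrite mulr0 mcoeff0.
rewrite mulr1 mcoeffZ mcoeffX; case: eqP => [->|]; last by rewrite mulr0.
by rewrite Jg ?mul0r.
Qed.

Lemma adj_homog J f e : is_ideal J -> homog_ideal J -> grading f = f *: 'X^e ->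
  homog_ideal (ideal_adj J f).
Proof.
move=> idJ hJ hf g [h Jh] d.
(* the component of degree d of f h is f times that of degree d - e of h *)
exists (if (d < e)%N then 0 else (grading h)`_(d - e)).
have := hJ _ Jh d; rewrite rmorphB rmorphM /= hf coefB -scalerAl coefZ coefXnM.
by [].
Qed.

(** A graded Krull intersection: in degrees smaller than n nothing of x^n h
remains, so the low components of g lie in J, and g has finitely many
components. *)
Lemma homog_separated J x g : is_ideal J -> homog_ideal J -> grading x = x *: 'X ->
  (forall n, exists h, J (g - x ^+ n * h)) -> J g.
Proof.
move=> idJ hJ hx sep; rewrite -(grading1 g) horner_coef; apply: (idl_sum idJ) => i _.
rewrite expr1n mulr1; have [h Jh] := sep (size (grading g)).
have := hJ _ Jh i; rewrite rmorphB rmorphM rmorphXn /= hx coefB exprZn -scalerAl.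
by rewrite coefZ coefXnM ltn_ord mulr0 subr0.
Qed.

End NonFace.

(** * Elementary symmetric polynomials as a universal regular sequence *)

Section AdjSeq.
Local Open Scope ring_scope.
Variable R : comNzRingType.
Implicit Types (J K : R -> Prop) (f g h x : R) (s fs : seq R).

Definition ideal_adjs J fs : R -> Prop := foldl (@ideal_adj R) J fs.

Lemma eq_ideal_adjs fs J K : (forall g, J g <-> K g) ->
  forall g, ideal_adjs J fs g <-> ideal_adjs K fs g.
Proof. by elim: fs J K => //= f fs IH J K JK; apply/IH/eq_ideal_adj. Qed.

Lemma ideal_adjs_is_ideal fs J : is_ideal J -> is_ideal (ideal_adjs J fs).
Proof. by elim: fs J => //= f fs IH J idJ; apply/IH/ideal_adj_is_ideal. Qed.

Lemma ideal_adjs_sub fs J g : J g -> ideal_adjs J fs g.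
Proof. by elim: fs J => //= f fs IH J Jg; apply/IH/ideal_adj_sub. Qed.

Lemma weakly_regular_rcons fs f J :
  weakly_regular J fs -> nzd (ideal_adjs J fs) f -> weakly_regular J (rcons fs f).
Proof. by elim: fs J => //= h fs IH J [nzh regfs] /(IH _ regfs). Qed.

Lemma ideal_adjs_adj fs J x g :
  ideal_adjs (ideal_adj J x) fs g <-> ideal_adj (ideal_adjs J fs) x g.
Proof.
elim: fs J => //= f fs IH J.
by rewrite -IH; apply: eq_ideal_adjs => h; apply: ideal_adjC.
Qed.

(** Part of the permutability of regular sequences that holds in any ring: if
x, f_1, ..., f_r is regular then x stays regular modulo f_1, ..., f_r. *)
Lemma nzd_adjs fs J x : is_ideal J -> nzd J x -> weakly_regular (ideal_adj J x) fs ->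
  nzd (ideal_adjs J fs) x.
Proof.
elim: fs J => //= f fs IH J idJ nzx [nzf regfs]; apply: IH;
  first exact: ideal_adj_is_ideal.
- move=> g [h Jh].
  have [h' Jh'] : ideal_adj J x h.
    apply: nzf; exists g.
    have -> : f * h - x * g = - (x * g - f * h) by ring.
    exact: idlN.
  exists h'; apply: nzx.
  have -> : x * (g - f * h') = (x * g - f * h) + f * (h - x * h') by ring.
  by apply: (idlD idJ) => //; apply: idlMl.
- by apply: eq_weakly_regular regfs => g; apply: ideal_adjC.
Qed.

Lemma nzd_prod I (r : seq I) (P : pred I) (F : I -> R) J :
  (forall i, P i -> nzd J (F i)) -> nzd J (\prod_(i <- r | P i) F i).
Proof.
move=> H; apply: big_ind => //; first by move=> g; rewrite mul1r.
by move=> f h nf nh g; rewrite -mulrA => /nf/nh.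
Qed.

Lemma nzd_congr J f f' : is_ideal J -> J (f - f') -> nzd J f' -> nzd J f.
Proof.
move=> idJ Jff nf' g Jfg; apply: nf'.
have -> : f' * g = f * g - (f - f') * g by ring.
by apply: (idlB idJ) => //; apply: (idlMr idJ).
Qed.

(** The other part, up to x-adic closure: if e is regular modulo x, then a
multiple e g that vanishes forces g to be divisible by every power of x. *)
Lemma adj_pow J e x g : is_ideal J -> nzd J x -> nzd (ideal_adj J x) e ->
  J (e * g) -> forall n, exists h, J (g - x ^+ n * h).
Proof.
move=> idJ nzx nze Jeg; elim=> [|n [h Jh]].
  by exists g; rewrite mul1r subrr; apply: idl0.
(* cancel x^n in e x^n h to find that e h, hence h, is divisible by x *)
have nzxn : nzd J (x ^+ n).
  by elim: (n) => [|i IHi] a; rewrite ?mul1r // exprS -mulrA => /nzx/IHi.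
have [h' Jh'] : ideal_adj J x h.
  apply/nze/ideal_adj_sub/nzxn.
  have -> : x ^+ n * (e * h) = e * g - e * (g - x ^+ n * h) by ring.
  by apply: (idlB idJ) => //; apply: idlMl.
exists h'; rewrite exprSr.
have -> : g - x ^+ n * x * h' = (g - x ^+ n * h) + x ^+ n * (h - x * h') by ring.
by apply: (idlD idJ) => //; apply: idlMl.
Qed.

End AdjSeq.

Section Leaf.
Local Open Scope ring_scope.
Variables (k : fieldType) (N : nat).
Local Notation S := {mpoly k[N]}.
Implicit Types (A B W : {set 'I_N}) (D : {set 'I_N} -> bool) (m : 'X_{1..N}) (g h : S).

Definition esyms d : seq S := [seq mesym N k i.+1 | i <- iota 0 d].

Lemma esymsS d : esyms d.+1 = rcons (esyms d) (mesym N k d.+1).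
Proof. by rewrite /esyms -(addn1 d) iotaD map_cat cats1 addn1. Qed.

Lemma size_esyms d : size (esyms d) = d.
Proof. by rewrite size_map size_iota. Qed.

Lemma grading_mesym d : grading (mesym N k d) = mesym N k d *: 'X^d.
Proof.
rewrite mesymE rmorph_sum scaler_suml; apply: eq_bigr => h /eqP hd.
by rewrite /= grading_X mdeg_mesym1 hd.
Qed.

Local Notation simplex W := (fun A : {set 'I_N} => A \subset W).

Lemma downclosed_simplex W : downclosed (simplex W).
Proof. by move=> A B; apply: subset_trans. Qed.

Lemma simplex_homog W d :
  homog_ideal (ideal_adjs (nonface_ideal (k := k) (simplex W)) (esyms d)).
Proof.
elim: d => [|d IH]; first exact: nonface_homog.
rewrite esymsS /ideal_adjs foldl_rcons.
apply: (adj_homog _ IH (grading_mesym d.+1)).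
exact/ideal_adjs_is_ideal/nonface_ideal_is_ideal/downclosed_simplex.
Qed.

Lemma eq_nonface D D' : D =1 D' -> forall g,
  nonface_ideal D g <-> nonface_ideal D' g.
Proof. by move=> E g; split=> H m; [rewrite -E | rewrite E]; apply: H. Qed.

Lemma simplex_nzd W w : w \in W -> nzd (nonface_ideal (k := k) (simplex W)) 'X_w.
Proof.
move=> wW g /(nonface_colon _ (@downclosed_simplex W)).
by apply: (eq_nonface _ g).1 => A /=; rewrite subUset sub1set wW.
Qed.

Lemma simplex_adj W w : forall g,
  ideal_adj (nonface_ideal (k := k) (simplex W)) 'X_w g <->
  nonface_ideal (simplex (W :\ w)) g.
Proof.
move=> g; rewrite -nonface_adj; last exact: downclosed_simplex.
by apply: eq_nonface => A /=; rewrite subsetD1 andbC.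
Qed.

(** Every other squarefree monomial of degree #|W| involves a variable outside W. *)
Lemma mesym_simplex W : nonface_ideal (simplex W)
  (mesym N k #|W| - \prod_(w in W) 'X_w).
Proof.
have idJ := @nonface_ideal_is_ideal k _ _ (@downclosed_simplex W).
rewrite /mesym (bigD1 W) //= addrAC subrr add0r;
  apply: (idl_sum idJ) => h /andP[/eqP hW hnW].
have [v vh vW] : exists2 v, v \in h & v \notin W.
  by apply/subsetPn; apply: contra hnW => hs; rewrite eqEcard hs hW /=.
rewrite (bigD1 v) //=; apply: (idlMr idJ); apply: nonface_idealX.
by rewrite msupport1 sub1set.
Qed.

(** By induction on d and on #|W|. Modulo x_w the claim for W becomes the claim
for W minus w, and x_w is regular modulo e_1, ..., e_d; since everything is
graded, e_(d+1) is then regular, provided that W has more than d+1 elements.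
If #|W| = d+1, then e_(d+1) is the product of the regular elements x_w. *)
Lemma simplex_weakly_regular d W : (d <= #|W|)%N ->
  weakly_regular (nonface_ideal (simplex W)) (esyms d).
Proof.
elim: d W => // d IH W dW; rewrite esymsS.
apply: weakly_regular_rcons; first by apply: IH; apply: ltnW.
have [n] := ubnP #|W|; elim: n W dW => // n IHn W dW; rewrite ltnS => Wn.
have idJ W' := @nonface_ideal_is_ideal k _ _ (@downclosed_simplex W').
have nzw w : w \in W ->
    nzd (ideal_adjs (nonface_ideal (simplex W)) (esyms d)) ('X_w : S).
  move=> wW; apply: nzd_adjs => //; first exact: simplex_nzd.
  have : weakly_regular (nonface_ideal (simplex (W :\ w))) (esyms d).
    by apply: IH; move: dW; rewrite (cardsD1 w) wW.
  by apply: eq_weakly_regular => g; rewrite simplex_adj.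
have [dE|dN] := eqVneq #|W| d.+1.
  rewrite -dE; apply: nzd_congr (nzd_prod nzw); first exact: ideal_adjs_is_ideal.
  exact/ideal_adjs_sub/mesym_simplex.
have [w wW] : exists w, w \in W by apply/set0Pn; rewrite -card_gt0; lia.
have cW : #|W| = #|W :\ w|.+1 by rewrite (cardsD1 w) wW.
move=> g Jg; apply: (homog_separated (x := 'X_w)).
- exact: ideal_adjs_is_ideal.
- exact: simplex_homog.
- by rewrite grading_X mdeg1.
apply: adj_pow Jg; first exact: ideal_adjs_is_ideal.
  exact: nzw.
move=> h; rewrite -!ideal_adjs_adj.
rewrite !(eq_ideal_adjs _ (simplex_adj W w)).
move: dW dN Wn; rewrite cW eqSS ltnS => dW dN Wn.
by apply: IHn => //; rewrite ltn_neqAle eq_sym dN.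
Qed.

End Leaf.

(** * Branching on vertices and maximal independent sets *)

Section Graph.
Local Open Scope ring_scope.
Variables (N : nat) (e : rel 'I_N).
Implicit Types (A B C U W Y : {set 'I_N}) (u v : 'I_N).

Definition indep A := [forall u in A, forall v in A, ~~ e u v].

Lemma indepP A : reflect {in A &, forall u v, ~~ e u v} (indep A).
Proof.
apply: (iffP forall_inP) => H u; first by move=> v uA vA; apply: (forall_inP (H u uA)).
by move=> uA; apply/forall_inP => v; apply: H.
Qed.

Lemma indep_sub A B : A \subset B -> indep B -> indep A.
Proof.
move=> /subsetP AB /indepP iB; apply/indepP => u v uA vA.
by apply: iB; apply: AB.
Qed.

Definition indep_in U A := (A \subset U) && indep A.

Lemma downclosed_indep_in U : downclosed (indep_in U).
Proof.
by move=> A B AB /andP[BU iB]; rewrite /indep_in (subset_trans AB BU) (indep_sub AB).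
Qed.

Definition nbr v : {set 'I_N} := [set u | e v u].

(** The recursion tree of the lower bound: [branch_bound U d] holds if branching
on vertices reduces the graph induced on U to edgeless graphs with at least d
vertices each. *)
Inductive branch_bound : {set 'I_N} -> nat -> Prop :=
| branch_bound_indep U d : indep U -> (d <= #|U|)%N -> branch_bound U d
| branch_bound_step U v d : v \in U -> branch_bound (U :\: nbr v) d ->
  branch_bound (U :\ v) d -> branch_bound U d.

Definition maximal_indep U W :=
  [/\ W \subset U, indep W & forall u, u \in U -> u \notin W ->
    exists2 w, w \in W & e u w].

Definition has_maximal_indep U d := exists2 W, maximal_indep U W & #|W| = d.

(** Disjoint vertex sets without edges between them, whose graph is the disjoint
union of the two induced graphs. *)
Definition separated U1 U2 :=
  [disjoint U1 & U2] /\ {in U1 & U2, forall u v, ~~ e u v}.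

Hypotheses (e_sym : ssrbool.symmetric e) (e_irr : irreflexive e).

Lemma indepU1 v A : indep (v |: A) = indep A && [disjoint A & nbr v].
Proof.
apply/idP/andP.
  move=> /indepP iA; split; first by apply/indepP => u w uA wA; apply: iA;
    rewrite !inE ?uA ?wA orbT.
  apply/pred0P=> u /=; apply/negP => /andP[uA]; rewrite inE; apply/negP.
  by apply: iA; rewrite !inE ?eqxx ?uA ?orbT.
move=> [/indepP iA dA]; apply/indepP => u w; rewrite !inE.
have nv x : x \in A -> ~~ e v x.
  by move=> xA; have := disjointFr dA xA; rewrite inE => ->.
move=> /predU1P[->|uA] /predU1P[->|wA]; first by rewrite e_irr.
- exact: nv.
- by rewrite e_sym nv.
- exact: iA.
Qed.

Lemma indep_in_colon U v A : v \in U ->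
  indep_in U (v |: A) = indep_in (U :\: nbr v) A.
Proof.
move=> vU; rewrite /indep_in subUset sub1set vU indepU1 subsetD /=.
by rewrite -!andbA; do 2 bool_congr; case: indep; rewrite ?andbT ?andbF.
Qed.

(** The colon by x_v kills the neighbours of v and adjoining x_v deletes v. *)
Lemma branch_bound_regular (k : fieldType) U d : branch_bound U d ->
  weakly_regular (nonface_ideal (indep_in U)) (esyms k N d).
Proof.
elim=> {U d} [U d iU dU|U v d vU _ IH1 _ IH2].
  apply: eq_weakly_regular (simplex_weakly_regular k dU) => g; apply: eq_nonface => A.
  by rewrite /indep_in; case: (boolP (A \subset U)) => // AU; rewrite (indep_sub AU).
have dU := @downclosed_indep_in U.
apply: (weakly_regular_branch (x := 'X_v)); first exact: nonface_ideal_is_ideal.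
  apply: eq_weakly_regular IH1 => g; rewrite -nonface_colon //; apply: eq_nonface => A.
  by rewrite indep_in_colon.
apply: eq_weakly_regular IH2 => g; rewrite -nonface_adj //; apply: eq_nonface => A.
by rewrite /indep_in subsetD1 andbCA andbA.
Qed.

Lemma branch_bound_le U d d' : (d' <= d)%N -> branch_bound U d -> branch_bound U d'.
Proof.
move=> dd H; elim: H d' dd => {U d} [U d iU dU d' dd|U v d vU _ IH1 _ IH2 d' dd].
  by apply: branch_bound_indep => //; apply: leq_trans dU.
by apply: branch_bound_step vU _ _; [apply: IH1 | apply: IH2].
Qed.

Lemma separated_sym U1 U2 : separated U1 U2 -> separated U2 U1.
Proof.
case=> d12 n12; split; first by rewrite disjoint_sym.
by move=> u v u2 v1; rewrite e_sym; apply: n12.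
Qed.

Lemma separated_sub U1 U1' U2 : U1' \subset U1 -> separated U1 U2 -> separated U1' U2.
Proof.
move=> s1 [d12 n12]; split; first exact: disjointWl d12.
by move=> u v /(subsetP s1); apply: n12.
Qed.

Lemma indepU U1 U2 : separated U1 U2 -> indep U1 -> indep U2 -> indep (U1 :|: U2).
Proof.
move=> [_ n12] /indepP i1 /indepP i2; apply/indepP => u v.
rewrite !inE => /orP[]uU /orP[]vU; [exact: i1 | exact: n12 | | exact: i2].
by rewrite e_sym n12.
Qed.

Lemma separatedD U1 U2 v : v \in U1 -> separated U1 U2 ->
  (U1 :|: U2) :\: nbr v = (U1 :\: nbr v) :|: U2.
Proof.
move=> v1 [_ n12]; apply/setP=> u; rewrite !inE.
by case u2 : (u \in U2); rewrite ?orbF // !orbT andbT n12.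
Qed.

Lemma separatedD1 U1 U2 v : v \in U1 -> separated U1 U2 ->
  (U1 :|: U2) :\ v = (U1 :\ v) :|: U2.
Proof.
move=> v1 [d12 _]; apply/setP=> u; rewrite !inE.
case: (u =P v) => [->|_] //=; by rewrite (disjointFr d12 v1).
Qed.

(** The tree for the second graph is grafted on the leaves of the tree for the
first. *)
Lemma branch_boundU U1 U2 d1 d2 : separated U1 U2 -> branch_bound U1 d1 ->
  branch_bound U2 d2 ->
  branch_bound (U1 :|: U2) (d1 + d2).
Proof.
move=> s12 H1 H2; elim: H1 s12 => {U1 d1} [U1 d1 i1 c1|U1 v d v1 _ IH1 _ IH2] s12.
  elim: H2 s12 => {U2 d2} [U2 d2 i2 c2|U2 v d v2 _ IH1 _ IH2] s12.
    apply: branch_bound_indep; first exact: indepU.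
    rewrite cardsU; case: s12; rewrite -setI_eq0 => /eqP -> _.
    by rewrite cards0 subn0 leq_add.
  have s21 := separated_sym s12.
  apply: (@branch_bound_step _ v); rewrite ?inE ?v2 ?orbT // setUC.
    rewrite separatedD // setUC; apply: IH1; apply/separated_sym/(separated_sub _ s21).
    exact: subsetDl.
  rewrite separatedD1 // setUC; apply: IH2; apply/separated_sym/(separated_sub _ s21).
  exact: subsetDl.
apply: (@branch_bound_step _ v); rewrite ?inE ?v1 //.
  rewrite separatedD //; apply: IH1; apply/(separated_sub _ s12).
  exact: subsetDl.
rewrite separatedD1 //; apply: IH2; apply/(separated_sub _ s12).
exact: subsetDl.
Qed.

Lemma maximal_indepU U1 U2 W1 W2 : separated U1 U2 ->
  maximal_indep U1 W1 -> maximal_indep U2 W2 -> maximal_indep (U1 :|: U2) (W1 :|: W2).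
Proof.
move=> s12 [s1 i1 m1] [s2 i2 m2]; split; first exact: setUSS.
  apply: indepU => //; apply: (separated_sub s1); apply: separated_sym.
  exact/(separated_sub s2)/separated_sym.
move=> u; rewrite !inE negb_or => /orP[]uU /andP[u1 u2].
  by have [w wW euw] := m1 u uU u1; exists w; rewrite ?inE ?wW.
by have [w wW euw] := m2 u uU u2; exists w; rewrite ?inE ?wW ?orbT.
Qed.

Lemma has_maximal_indepU U1 U2 d1 d2 : separated U1 U2 -> has_maximal_indep U1 d1 ->
  has_maximal_indep U2 d2 ->
  has_maximal_indep (U1 :|: U2) (d1 + d2).
Proof.
move=> s12 [W1 m1 <-] [W2 m2 <-]; exists (W1 :|: W2); first exact: maximal_indepU.
case: m1 m2 s12 => s1 _ _ [s2 _ _] [d12 _]; rewrite cardsU.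
have := disjointWl s1 (disjointWr s2 d12).
by rewrite -setI_eq0 => /eqP->; rewrite cards0 subn0.
Qed.

Lemma maximal_indep1 U v W : v \in U ->
  maximal_indep (U :\: (v |: nbr v)) W -> maximal_indep U (v |: W).
Proof.
move=> vU [sW iW mW]; split.
- by rewrite subUset sub1set vU; apply: subset_trans sW (subsetDl _ _).
- rewrite indepU1 iW /=; move: sW; rewrite subsetD => /andP[_].
  by apply: disjointWr; apply: subsetUr.
- move=> u uU; rewrite !inE negb_or => /andP[uv uW].
  case: (boolP (e v u)) => evu; first by exists v; rewrite ?inE ?eqxx // e_sym.
  have [|//|w wW euw] := mW u; first by rewrite !inE negb_or uv evu.
  by exists w => //; rewrite !inE wW orbT.
Qed.

Lemma has_maximal_indep_step U v d : v \in U ->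
  has_maximal_indep (U :\: (v |: nbr v)) d -> has_maximal_indep U d.+1.
Proof.
move=> vU [W mW <-]; exists (v |: W); first exact: maximal_indep1.
rewrite cardsU1; case: mW => /subsetP sW _ _.
by case: (boolP (v \in W)) => // /sW; rewrite !inE eqxx.
Qed.

Lemma has_maximal_indep0 : has_maximal_indep set0 0.
Proof.
exists set0; rewrite ?cards0 //; split=> //; first by apply/indepP => u v; rewrite inE.
by move=> u; rewrite inE.
Qed.

End Graph.

(** * Koszul classes from links of faces *)

Section Class.
Local Open Scope ring_scope.
Variables (k : fieldType) (N : nat) (e : rel 'I_N).
Local Notation S := {mpoly k[N]}.
Implicit Types (A B C U W Y : {set 'I_N}) (u v : 'I_N).

Definition sqvar (v : 'I_N) : S := 'X_v ^+ 2.

(** The simplicial coboundary of the link of Y, for cochains indexed by the faces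
of the whole complex that contain Y; the index set of the sum keeps Y fixed. *)
Definition cobound Y (psi : {set 'I_N} -> k) A : k :=
  \sum_(v in A :\: Y) (-1) ^+ ord_pos v A * psi (A :\ v).

(** A nonzero class of degree d - #|Y| - 1 in the reduced cohomology of the link
of Y in the independence complex: a cocycle [class_phi], and a cycle on which
it does not vanish. The cycle is the family [class_set] of faces weighted by
[class_coef]; that it is a cycle is expressed by its vanishing on all
coboundaries. *)
Record indep_class Y (d : nat) : Prop := IndepClass {
  class_phi : {set 'I_N} -> k;
  class_T : finType;
  class_coef : class_T -> k;
  class_set : class_T -> {set 'I_N};
  class_supp : forall A, class_phi A != 0 -> Y \subset A;
  class_cocycle : forall A, Y \subset A -> indep e A -> #|A| = d.+1 ->
    cobound Y class_phi A = 0;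
  class_setP : forall t,
    [/\ Y \subset class_set t, indep e (class_set t) & #|class_set t| = d];
  class_cycle : forall psi, \sum_t class_coef t * cobound Y psi (class_set t) = 0;
  class_pair : \sum_t class_coef t * class_phi (class_set t) != 0 }.

(** The multidegree in which the class lives: degree one in the variables of Y
and degree two in the other variables of A. In local cohomology it corresponds
to degree -1 on Y and 0 elsewhere. *)
Definition class_mon Y A : 'X_{1..N} :=
  [multinom (if v \in Y then 1 else (v \in A).*2)%N | v < N].

Lemma msupport_class_mon Y A : msupport (class_mon Y A) = A :|: Y.
Proof.
apply/setP=> v; rewrite !inE mnmE; case: (v \in Y); first by rewrite orbT.
by case: (v \in A).
Qed.

Lemma class_monD1 Y A v : v \in A :\: Y ->
  class_mon Y A = (U_(v) *+ 2 + class_mon Y (A :\ v))%MM.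
Proof.
rewrite inE => /andP[vY vA]; apply/mnmP=> u; rewrite mnmDE mulmnE mnm1E !mnmE !inE.
by case: eqP => [<-|]; rewrite ?(negPf vY) ?vA ?eqxx //= ; case: eqP => // ->.
Qed.

(** The cochain is phi(A) times the monomial [class_mon Y A] at A. Its coboundary
is that of phi times a monomial, which lies in the ideal unless A is a face.
If it were the coboundary of b, then extracting the coefficient of
[class_mon Y A] would exhibit phi as a coboundary on the faces of the cycle:
the terms of index v in Y drop out since the square of x_v does not divide
that monomial. *)
Lemma not_koszul_exact Y d : indep_class Y d ->
  ~ koszul_exact sqvar (nonface_ideal (k := k) (indep e)) d.
Proof.
case=> phi T z At phiY cocyc AtP cyc pair.
have iff_id : downclosed (indep e) by move=> A B; apply: indep_sub.
have idJ := @nonface_ideal_is_ideal k _ _ iff_id.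
move=> /(_ (fun A => phi A *: 'X_[class_mon Y A]))[].
  move=> A cA; have [YA|YA] := boolP (Y \subset A); last first.
    rewrite /koszul big1; first exact: idl0.
    move=> v vA; case: (eqVneq (phi (A :\ v)) 0) => [->|/phiY YAv].
      by rewrite scale0r !mulr0.
    by rewrite (subset_trans YAv (subsetDl _ _)) in YA.
  have -> : koszul sqvar (fun B => phi B *: 'X_[class_mon Y B]) A =
            cobound Y phi A *: 'X_[class_mon Y A].
    rewrite /koszul (big_setID Y) /= big1 ?add0r => [|v]; last first.
      rewrite inE => /andP[vA vY]; case: (eqVneq (phi (A :\ v)) 0) =>
        [->|/phiY/subsetP/(_ v vY)].
        by rewrite scale0r !mulr0.
      by rewrite !inE eqxx.
    rewrite scaler_suml; apply: eq_bigr => v vAY.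
    rewrite (class_monD1 vAY) mpolyXD -mpolyXn -scalerAr -scalerA.
    by rewrite -(signr_odd S) -(signr_odd k); case: odd;
      rewrite ?expr0 ?expr1 ?mul1r ?scale1r // !mulN1r scaleN1r.
  case: (boolP (indep e A)) => iA; first by rewrite cocyc // scale0r; apply: idl0.
  rewrite -mul_mpolyC; apply: (idlMl idJ); apply: nonface_idealX.
  by rewrite msupport_class_mon; apply: contra iA; apply/indep_sub/subsetUl.
move=> b Jb; case/eqP: pair; apply: etrans (cyc (fun B => (b B)@_(class_mon Y B))).
apply: eq_bigr => t _; congr (_ * _).
have [YA iA cA] := AtP t; move: (At t) YA iA cA => A YA iA cA.
have := Jb A cA (class_mon Y A); rewrite msupport_class_mon (setUidPl YA) => /(_ iA).
rewrite mcoeffB mcoeffZ mcoeffX eqxx mulr1 => /eqP; rewrite subr_eq0 => /eqP ->.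
rewrite /koszul (big_setID Y) /= raddfD /= !raddf_sum /= big1 ?add0r => [|v].
  apply: eq_bigr => v vAY.
  have sgnE (n : nat) (p : S) m : ((-1) ^+ n * p)@_m = (-1) ^+ n * p@_m.
    by rewrite -(signr_odd S) -(signr_odd k); case: odd;
      rewrite ?expr0 ?expr1 ?mul1r // !mulN1r mcoeffN.
  rewrite sgnE; congr (_ * _).
  by rewrite (class_monD1 vAY) /sqvar mpolyXn mulrC mcoeffMX.
rewrite inE => /andP[vA vY]; apply: mcoeffM0 => m1 m2 mE.
rewrite [X in _ * X]mcoeffM0 ?mulr0 // => m3 m4 mE'.
rewrite /sqvar mpolyXn mcoeffX; case: eqP => [E|]; last by rewrite mul0r.
move/mnmP/(_ v): mE; rewrite mE' mnmE vY !mnmDE -E mulmnE mnm1E eqxx; lia.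
Qed.

(** The link of a facet is the empty sphere: the indicator function of W is a
cocycle because W is contained in no larger face, and the cycle is W itself. *)
Lemma maximal_indep_class W : maximal_indep e [set: 'I_N] W -> indep_class W #|W|.
Proof.
case=> _ iW mW.
apply: (@IndepClass W #|W| (fun A => (A == W)%:R) unit (fun=> 1) (fun=> W)).
- by move=> A; case: (A =P W) => [->|]; rewrite ?eqxx.
- move=> A WA /indepP iA _; apply: big1 => v; rewrite !inE => /andP[vW vA].
  have [|//|w wW evw] := mW v; first by rewrite inE.
  by have := iA v w vA (subsetP WA _ wW); rewrite evw.
- by move=> _; rewrite subxx.
- by move=> psi; rewrite big1 // => t _; rewrite /cobound setDv big_set0 mulr0.
- by rewrite big_const card_unit /= addr0 mul1r eqxx oner_eq0.
Qed.

End Class.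

(** * The depth of an edge ideal *)

Section Depth.
Local Open Scope ring_scope.
Variables (k : fieldType) (N : nat) (e : rel 'I_N).
Hypotheses (e_sym : ssrbool.symmetric e) (e_irr : irreflexive e).
Local Notation S := {mpoly k[N]}.

(** Either order of the factors is accepted, as a symmetric adjacency relation
meets each generator twice. *)
Definition edge_gens (s : seq S) : Prop :=
  (forall f, f \in s -> exists u v, e u v /\ f = 'X_u * 'X_v) /\
  (forall u v, e u v -> 'X_u * 'X_v \in s \/ 'X_v * 'X_u \in s).

Lemma edge_idealE s : edge_gens s -> forall f,
  in_ideal s f <-> nonface_ideal (indep e) f.
Proof.
move=> [sE Es] f; split.
  move: f; apply: in_ideal_min => [|f /sE[u [v [euv ->]]]].
    by apply: nonface_ideal_is_ideal => A B; apply: indep_sub.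
  rewrite -mpolyXD; apply: nonface_idealX; rewrite msupportD !msupport1.
  by apply/negP => /indepP/(_ u v); rewrite !inE !eqxx orbT euv => /(_ isT isT).
move=> Jf; rewrite [f]mpolyE; have idI := in_ideal_is_ideal s; rewrite big_seq.
apply: (idl_sum idI) => m.
rewrite mcoeff_msupp -mul_mpolyC => fm; apply: (idlMl idI).
(* a monomial of f has an edge in its support, hence is a multiple of a generator *)
have : ~~ indep e (msupport m) by apply: contra fm => /Jf->.
case/forall_inPn => u um /forall_inPn[v vm /negPn euv].
have uv : u != v by apply: contraTneq euv => ->; rewrite e_irr.
have le : (U_(u) + U_(v) <= m)%MM.
  apply/mnm_lepP => w; rewrite mnmDE !mnm1E; move: um vm; rewrite !inE => um vm.
  case: (u =P w) => [<-|_]; last by case: (v =P w) => [<-|//]; rewrite lt0n.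
  by rewrite eq_sym (negPf uv) lt0n.
rewrite -(submK le) mpolyXD; apply: (idlMl idI); rewrite mpolyXD.
by case: (Es _ _ euv) => [|H]; [|rewrite mulrC]; exact: in_ideal_gen.
Qed.

(** The elements with a power in a given ideal form an ideal, and the variables
belong to it. *)
Lemma max_ideal_nilp f : in_ideal (max_ideal k N) f ->
  exists p (g : 'I_N -> S), f ^+ p = \sum_v g v * sqvar k v.
Proof.
pose K h := exists g : 'I_N -> S, h = \sum_v g v * sqvar k v.
have idK : is_ideal K.
  split.
  - by exists (fun=> 0); rewrite big1 // => v _; rewrite mul0r.
  - move=> _ _ [g ->] [g' ->]; exists (fun v => g v + g' v).
    by rewrite -big_split; apply: eq_bigr => v _; rewrite mulrDl.
  - move=> h _ [g ->]; exists (fun v => h * g v).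
    by rewrite mulr_sumr; apply: eq_bigr => v _; rewrite mulrA.
suff H : forall f, in_ideal (max_ideal k N) f -> exists p, K (f ^+ p) by apply: H.
apply: in_ideal_min => [|h].
  split; first by exists 1%N; rewrite expr1; apply: idl0.
    move=> g h [p Kp] [q Kq]; exists (p + q)%N; rewrite exprDn.
    apply: (idl_sum idK) => i _; rewrite -mulr_natl; apply: (idlMl idK).
    (* in (g + h)^(p+q) every term contains g^p or h^q *)
    have [qi|iq] := leqP q i.
      by rewrite -(subnKC qi) exprD; apply/(idlMl idK)/(idlMr idK).
    have -> : (p + q - i = p + (q - i))%N by lia.
    by rewrite exprD; apply/(idlMr idK)/(idlMr idK).
  by move=> g h [p Kp]; exists p; rewrite exprMn; apply: (idlMl idK).
case/mapP=> v _ ->; exists 2%N, (fun u => (u == v)%:R).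
rewrite (bigD1 v) //= eqxx mul1r big1 ?addr0 // => u /negPf->.
by rewrite mul0r.
Qed.

Lemma mesym_max_ideal i : in_ideal (max_ideal k N) (mesym N k i.+1).
Proof.
have idM := in_ideal_is_ideal (max_ideal k N).
apply: (idl_sum idM) => h /eqP hi.
have [v vh] : exists v, v \in h by apply/set0Pn; rewrite -card_gt0 hi.
rewrite (bigD1 v) //=; apply: (idlMr idM); apply: in_ideal_gen.
by apply: map_f; rewrite mem_enum.
Qed.

Lemma in_ideal_coef0 s (f : S) : (forall g, g \in s -> g@_0%MM = 0) ->
  in_ideal s f -> f@_0%MM = 0.
Proof.
move=> s0; move: f; apply: in_ideal_min => //.
split; first by rewrite mcoeff0.
- by move=> f g /= f0 g0; rewrite mcoeffD f0 g0 addr0.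
- by move=> f g /= g0; rewrite rmorphM /= g0 mulr0.
Qed.

Lemma max_ideal_coef0 f : in_ideal (max_ideal k N) f -> f@_0%MM = 0.
Proof.
apply: in_ideal_coef0 => _ /mapP[v _ ->].
by rewrite mcoeffX mnm1_eq0.
Qed.

Theorem edge_depth s Y d : edge_gens s -> branch_bound e [set: 'I_N] d ->
  indep_class k e Y d -> depth (max_ideal k N) s = d.
Proof.
move=> sE bd cls; apply: depthE.
have JE g : nonface_ideal (indep_in e setT) g <-> in_ideal s g.
  rewrite edge_idealE //; apply: eq_nonface => A.
  by rewrite /indep_in subsetT.
split; last first.
  move=> fs [fsM [/weakly_regular_in_ideal regfs _]]; rewrite leqNgt; apply/negP => dfs.
  apply: (not_koszul_exact cls); apply: (weakly_regular_koszul_exact _ _ _ dfs).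
  - by apply: nonface_ideal_is_ideal => A B; apply: indep_sub.
  - by apply: eq_weakly_regular regfs => g; apply: edge_idealE.
  - by move=> f /fsM; apply: max_ideal_nilp.
exists (esyms k N d); last exact: size_esyms.
have esM f : f \in esyms k N d -> in_ideal (max_ideal k N) f.
  by case/mapP=> i _ ->; apply: mesym_max_ideal.
split=> //; split.
  by apply/weakly_regular_in_ideal; apply: eq_weakly_regular (branch_bound_regular
    e_sym e_irr k bd).
move/in_ideal_coef0; rewrite mcoeff1 eqxx => H; have/eqP := oner_neq0 k.
apply; apply: H => g; rewrite mem_cat => /orP[gs|/esM]; last exact: max_ideal_coef0.
have [/(_ _ gs)[u [v [_ ->]]] _] := sE.
by rewrite rmorphM /= mcoeffX mnm1_eq0 mul0r.
Qed.

End Depth.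

(** * Induced paths *)

Lemma ceil_div3 a : ceil_div a 3 = (a + 2) %/ 3.
Proof. rewrite /ceil_div; case: eqP => /=; lia. Qed.

Section Path.
Variables (N : nat) (e : rel 'I_N).
Hypotheses (e_sym : ssrbool.symmetric e) (e_irr : irreflexive e).
Variable f : nat -> 'I_N.

(** The vertices f p, ..., f (q-1). A path is given by an enumeration of its
vertices because one of those needed later runs around the cycle and is not
an interval of indices. *)
Definition seg p q : {set 'I_N} := [set v in [seq f i | i <- index_iota p q]].

Lemma segP p q v : reflect (exists2 i, p <= i < q & v = f i) (v \in seg p q).
Proof.
rewrite inE; apply: (iffP mapP) => -[i]; rewrite ?mem_index_iota => pq ->.
  by exists i.
by exists i; rewrite ?mem_index_iota.
Qed.

Definition induced_path p q :=
  forall i j, p <= i < q -> p <= j < q ->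
    (f i = f j -> i = j) /\ e (f i) (f j) = (j == i.+1) || (i == j.+1).

Section Induced.
Variables p q : nat.
Hypothesis pathf : induced_path p q.

Lemma mem_seg a b i : p <= a -> b <= q -> p <= i < q ->
  (f i \in seg a b) = (a <= i < b).
Proof.
move=> pa bq piq; apply/segP/idP => [[j jab]|]; last by exists i.
by have [||inj _] := pathf (i := i) (j := j); rewrite ?piq; [|lia|move/inj=> ->].
Qed.

Lemma seg_sub a b : p <= a -> b <= q -> seg a b \subset seg p q.
Proof.
move=> pa bq; apply/subsetP => v /segP[i iab ->]; apply/segP; exists i => //; lia.
Qed.

Lemma seg_ext (A B : {set 'I_N}) : A \subset seg p q -> B \subset seg p q ->
  (forall i, p <= i < q -> (f i \in A) = (f i \in B)) -> A = B.
Proof.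
move=> /subsetP sA /subsetP sB AB; apply/setP => v.
case: (segP p q v) => [[i ipq ->]|nv]; first exact: AB.
by apply/idP/idP => [/sA|/sB] vs; case: nv; exact/(segP p q v).
Qed.

Lemma mem_path_nbr i j : p <= i < q -> p <= j < q ->
  (f j \in nbr e (f i)) = (j == i.+1) || (i == j.+1).
Proof. by move=> ipq jpq; rewrite inE; case: (pathf ipq jpq). Qed.

Lemma eq_path_vertex i j : p <= i < q -> p <= j < q -> (f j == f i) = (j == i).
Proof.
move=> ipq jpq; apply/eqP/eqP => [|->//]; by case: (pathf jpq ipq).
Qed.

Lemma seg_separated a b c d : p <= a -> b < c -> d <= q ->
  separated e (seg a b) (seg c d).
Proof.
move=> pa bc dq; split.
  apply/pred0P => v /=; apply/negP => /andP[/segP[i iab ->]].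
  have [bq|qb] := leqP c d; last by move/segP => [j]; lia.
  by rewrite mem_seg; lia.
move=> u v /segP[i iab ->] /segP[j jcd ->].
have [||_ ->] := pathf (i := i) (j := j); lia.
Qed.

End Induced.

Lemma seg_nil p q : q <= p -> seg p q = set0.
Proof. by move=> qp; apply/setP => v; rewrite in_set0; apply/negbTE/negP => /segP[i];
  lia. Qed.

Lemma seg1 p : seg p p.+1 = [set f p].
Proof.
apply/setP => v; rewrite [RHS]inE; apply/segP/eqP => [[i ip ->]|->].
  by congr f; lia.
by exists p => //; lia.
Qed.

Lemma induced_path_sub p q a b : p <= a -> b <= q -> induced_path p q ->
  induced_path a b.
Proof. by move=> pa bq H i j iab jab; apply: H; lia. Qed.

Lemma branch_bound_seg1 p : branch_bound e (seg p p.+1) 1.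
Proof.
rewrite seg1; apply: branch_bound_indep; last by rewrite cards1.
by apply/indepP => u v; rewrite !inE => /eqP -> /eqP ->; rewrite e_irr.
Qed.

(** Branching at the second vertex isolates one vertex in both cases and leaves
a path with three, respectively two, vertices fewer. *)
Lemma path_branch_bound p q : induced_path p q ->
  branch_bound e (seg p q) (ceil_div (q - p) 3).
Proof.
have [n] := ubnP (q - p); elim: n p => // n IH p pqn pathf.
have [qp|pq] := leqP q p.
  rewrite seg_nil // (_ : q - p = 0); last by lia.
  by apply: branch_bound_indep; rewrite ?cards0 //; apply/indepP => u v; rewrite inE.
have [qp1|qp1] := leqP q p.+1.
  by rewrite (_ : q = p.+1) ?subSnn; [exact: branch_bound_seg1 | lia].
have IHs a : p < a -> branch_bound e (seg a q) (ceil_div (q - a) 3).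
  move=> pa; apply: IH; first by lia.
  by apply: induced_path_sub pathf; lia.
apply: (@branch_bound_step _ _ _ (f p.+1)); first by apply/segP; exists p.+1 => //; lia.
- have -> : seg p q :\: nbr e (f p.+1) = seg p.+1 p.+2 :|: seg p.+3 q.
    apply: (seg_ext (p := p) (q := q)); first exact: subsetDl.
      by rewrite subUset !seg_sub //; lia.
    move=> i ipq; rewrite in_setD in_setU (mem_path_nbr pathf) //; last by lia.
    by rewrite !(mem_seg pathf) //; lia.
  apply: (branch_bound_le (d := 1 + ceil_div (q - p.+3) 3));
    first by rewrite !ceil_div3; lia.
  apply: (branch_boundU e_sym); [|exact: branch_bound_seg1|by apply: IHs; lia].
  by apply: (seg_separated pathf); lia.
- have -> : seg p q :\ f p.+1 = seg p p.+1 :|: seg p.+2 q.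
    apply: (seg_ext (p := p) (q := q)); first exact: subsetDl.
      by rewrite subUset !seg_sub //; lia.
    move=> i ipq; rewrite in_setD1 in_setU (eq_path_vertex pathf) //; last by lia.
    by rewrite !(mem_seg pathf) //; lia.
  apply: (branch_bound_le (d := 1 + ceil_div (q - p.+2) 3));
    first by rewrite !ceil_div3; lia.
  apply: (branch_boundU e_sym); [|exact: branch_bound_seg1|by apply: IHs; lia].
  by apply: (seg_separated pathf); lia.
Qed.

(** The second vertex of the path dominates the first three. *)
Lemma path_maximal_indep p q : induced_path p q ->
  has_maximal_indep e (seg p q) (ceil_div (q - p) 3).
Proof.
have [n] := ubnP (q - p); elim: n p => // n IH p pqn pathf.
have [qp|pq] := leqP q p.
  rewrite seg_nil // (_ : q - p = 0); last by lia.
  exact: has_maximal_indep0.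
have IHs a : p < a -> has_maximal_indep e (seg a q) (ceil_div (q - a) 3).
  move=> pa; apply: IH; first by lia.
  by apply: induced_path_sub pathf; lia.
have [qp1|qp1] := leqP q p.+1.
  rewrite (_ : ceil_div (q - p) 3 = (ceil_div (q - p.+1) 3).+1); last first.
    by rewrite !ceil_div3; lia.
  apply: (@has_maximal_indep_step _ _ e_sym e_irr _ (f p)); first by apply/segP;
    exists p => //; lia.
  rewrite (_ : _ :\: _ = seg p.+1 q); first by apply: IHs.
  apply: (seg_ext (p := p) (q := q)); first exact: subsetDl.
    by rewrite seg_sub //; lia.
  move=> i ipq; rewrite in_setD in_setU1 (mem_path_nbr pathf) ?(eq_path_vertex pathf)
    //; try lia.
by rewrite !(mem_seg pathf) //; lia.
rewrite (_ : ceil_div (q - p) 3 = (ceil_div (q - p.+3) 3).+1); last first.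
  by rewrite !ceil_div3; lia.
apply: (@has_maximal_indep_step _ _ e_sym e_irr _ (f p.+1)); first by apply/segP;
  exists p.+1 => //; lia.
rewrite (_ : _ :\: _ = seg p.+3 q); first by apply: IHs; lia.
apply: (seg_ext (p := p) (q := q)); first exact: subsetDl.
  by rewrite seg_sub //; lia.
move=> i ipq; rewrite in_setD in_setU1 (mem_path_nbr pathf) ?(eq_path_vertex pathf)
  //; try lia.
by rewrite !(mem_seg pathf) //; lia.
Qed.

End Path.

(** * The cycle with a tail *)

Lemma mem_seg_inord N' a b (v : 'I_N'.+1) : b <= N'.+1 ->
  (v \in seg (@inord N') a b) = (a <= v < b).
Proof.
move=> bN; apply/segP/idP => [[i iab ->]|vab]; first by rewrite inordK //; lia.
by exists (v : nat); rewrite ?inord_val.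
Qed.

(** The vertex x_i has index i-1 and y_j has index n+j-1. The steps from i to i+1
follow both the cycle and the tail, except for the step from n-1 to n; the
other two cases close the cycle and join x_2 to y_1. *)
Definition tailed_cycle_arc n i j :=
  [|| (j == i.+1) && (j != n), (i.+1 == n) && (j == 0) | (i == 1) && (j == n)].

Definition tailed_cycle n N : rel 'I_N := fun u v => tailed_cycle_arc n u v ||
  tailed_cycle_arc n v u.

Section TailedCycle.
Variables (n m N' : nat).
Local Notation N := N'.+1.
Hypotheses (hn : 3 <= n) (hN : N = n + m).
Local Notation e := (@tailed_cycle n N).
Local Notation f0 := (@inord N').

Lemma tailed_cycle_sym : ssrbool.symmetric e.
Proof. by move=> u v; rewrite /tailed_cycle orbC. Qed.

Lemma tailed_cycle_irr : irreflexive e.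
Proof. move=> u; rewrite /tailed_cycle /tailed_cycle_arc; lia. Qed.

(** The path x_3, ..., x_n, x_1 that is left of the cycle without x_2. *)
Definition wrap i : 'I_N := inord (if i == n then 0 else i).

Lemma mem_seg_wrap v : (v \in seg wrap 2 n.+1) = (2 <= v < n) || (v == 0 :> nat).
Proof.
apply/segP/idP => [[i iab ->]|].
  by rewrite /wrap; case: (i =P n) => [_|ni]; rewrite inordK; lia.
have [v0 _|v0 vn] := eqVneq (v : nat) 0.
  by exists n; rewrite /wrap ?eqxx; [lia | apply: val_inj; rewrite /= inordK].
exists (v : nat); first by lia.
by rewrite /wrap; case: (_ =P n) => [|_]; [lia | rewrite inord_val].
Qed.

Lemma inord_path a b : b <= N -> (0 < a) && (b <= n) || (n <= a) ->
  induced_path e f0 a b.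
Proof.
move=> bN ab i j iab jab; split.
  by move/(congr1 val); rewrite /= !inordK; lia.
by rewrite /tailed_cycle /tailed_cycle_arc !inordK; lia.
Qed.

Lemma wrap_path : induced_path e wrap 2 n.+1.
Proof.
move=> i j iab jab; have iN : (if i == n then 0 else i) < N by case: eqP; lia.
have jN : (if j == n then 0 else j) < N by case: eqP; lia.
split.
  move/(congr1 val); rewrite /= !inordK //.
  by case: (i =P n); case: (j =P n); lia.
rewrite /wrap /tailed_cycle /tailed_cycle_arc !inordK //.
by case: (i =P n); case: (j =P n); lia.
Qed.

Lemma separatedI (A B : {set 'I_N}) :
  (forall u v, u \in A -> v \in B -> u != v /\ ~~ e u v) -> separated e A B.
Proof.
move=> H; split; last by move=> u v uA vB; case: (H u v uA vB).
apply/pred0P => u /=; apply/negP => /andP[uA uB].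
by have [] := H u u uA uB; rewrite eqxx.
Qed.

Let sE a b : b <= N -> forall v, (v \in seg f0 a b) = (a <= v < b).
Proof. by move=> bN v; apply: mem_seg_inord. Qed.

(** Branching at x_2. Removing its neighbours x_1, x_3 and y_1 leaves x_2 and two
paths; removing x_2 leaves two paths. *)
Lemma tailed_cycle_branch_bound d :
  d <= 1 + ceil_div (n - 3) 3 + ceil_div (m - 1) 3 ->
  d <= ceil_div (n - 1) 3 + ceil_div m 3 -> branch_bound e [set: 'I_N] d.
Proof.
move=> d1 d2.
apply: (@branch_bound_step _ _ _ (f0 1)); first by rewrite inE.
- have -> : setT :\: nbr e (f0 1) = (seg f0 1 2 :|: seg f0 3 n) :|: seg f0 n.+1 N.
    apply/setP => v; rewrite !in_setU !sE; try lia.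
    by rewrite !in_set /tailed_cycle /tailed_cycle_arc !inordK; try lia;
      have := ltn_ord v; lia.
  apply: (branch_bound_le d1); apply: (branch_boundU tailed_cycle_sym); last first.
  + have -> : m - 1 = N - n.+1 by lia.
    by apply: (path_branch_bound tailed_cycle_sym tailed_cycle_irr);
      apply: inord_path; lia.
  + apply: (branch_boundU tailed_cycle_sym); last first.
    * by apply: (path_branch_bound tailed_cycle_sym tailed_cycle_irr);
      apply: inord_path; lia.
    * exact: (branch_bound_seg1 tailed_cycle_irr).
    * apply: separatedI => u v; rewrite !sE; try lia.
      by rewrite -val_eqE /= /tailed_cycle /tailed_cycle_arc; lia.
  + apply: separatedI => u v; rewrite in_setU !sE; try lia.
    by rewrite -val_eqE /= /tailed_cycle /tailed_cycle_arc; lia.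
- have -> : setT :\ f0 1 = seg wrap 2 n.+1 :|: seg f0 n N.
    apply/setP => v; rewrite in_setU mem_seg_wrap sE; try lia.
    by rewrite in_setD1 in_setT -val_eqE /= inordK; try lia; have := ltn_ord v; lia.
  apply: (branch_bound_le d2); apply: (branch_boundU tailed_cycle_sym); last first.
  + have -> : m = N - n by lia.
    by apply: (path_branch_bound tailed_cycle_sym tailed_cycle_irr);
      apply: inord_path; lia.
  + have -> : n - 1 = n.+1 - 2 by lia.
    by apply: (path_branch_bound tailed_cycle_sym tailed_cycle_irr); apply: wrap_path.
  + apply: separatedI => u v; rewrite mem_seg_wrap sE; try lia.
    by rewrite -val_eqE /= /tailed_cycle /tailed_cycle_arc; lia.
Qed.

Let seg_maximal_indep a b : b <= N -> (0 < a) && (b <= n) || (n <= a) ->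
  has_maximal_indep e (seg f0 a b) (ceil_div (b - a) 3).
Proof.
by move=> bN ab; apply: (path_maximal_indep tailed_cycle_sym tailed_cycle_irr);
  apply: inord_path.
Qed.

(** A maximal independent set containing x_2. *)
Lemma tailed_cycle_maximal_indep_x2 : has_maximal_indep e [set: 'I_N] (1 + ceil_div (n
  - 3) 3 + ceil_div (m - 1) 3).
Proof.
apply: (@has_maximal_indep_step _ _ tailed_cycle_sym tailed_cycle_irr _ (f0 1));
  first by rewrite inE.
have -> : setT :\: (f0 1 |: nbr e (f0 1)) = seg f0 3 n :|: seg f0 n.+1 N.
  apply/setP => v; rewrite !in_setU !sE; try lia.
  rewrite in_setD in_setU1 in_setT in_set -val_eqE /= /tailed_cycle /tailed_cycle_arc
    !inordK; try lia.
  by have := ltn_ord v; lia.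
apply: (has_maximal_indepU tailed_cycle_sym); last 2 first.
- by apply: seg_maximal_indep; lia.
- by rewrite (_ : m - 1 = N - n.+1); [apply: seg_maximal_indep; lia | lia].
apply: separatedI => u v; rewrite !sE; try lia.
by rewrite -val_eqE /= /tailed_cycle /tailed_cycle_arc; lia.
Qed.

(** A maximal independent set containing y_1, which dominates x_2. *)
Lemma tailed_cycle_maximal_indep_y1 : 0 < m ->
  has_maximal_indep e [set: 'I_N] (1 + ceil_div (n - 1) 3 + ceil_div (m - 2) 3).
Proof.
move=> m0; apply: (@has_maximal_indep_step _ _ tailed_cycle_sym tailed_cycle_irr _ (f0
  n)); first by rewrite inE.
have -> : setT :\: (f0 n |: nbr e (f0 n)) = seg wrap 2 n.+1 :|: seg f0 n.+2 N.
  apply/setP => v; rewrite in_setU mem_seg_wrap sE; try lia.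
  rewrite in_setD in_setU1 in_setT in_set -val_eqE /= /tailed_cycle /tailed_cycle_arc
    !inordK; try lia.
  by have := ltn_ord v; lia.
apply: (has_maximal_indepU tailed_cycle_sym); last 2 first.
- have -> : n - 1 = n.+1 - 2 by lia.
  by apply: (path_maximal_indep tailed_cycle_sym tailed_cycle_irr); apply: wrap_path.
- by rewrite (_ : m - 2 = N - n.+2); [apply: seg_maximal_indep; lia | lia].
apply: separatedI => u v; rewrite mem_seg_wrap sE; try lia.
by rewrite -val_eqE /= /tailed_cycle /tailed_cycle_arc; lia.
Qed.

(** A maximal independent set containing y_2 and x_2. *)
Lemma tailed_cycle_maximal_indep_y2 : 1 < m ->
  has_maximal_indep e [set: 'I_N] (2 + ceil_div (n - 3) 3 + ceil_div (m - 3) 3).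
Proof.
move=> m1; apply: (@has_maximal_indep_step _ _ tailed_cycle_sym tailed_cycle_irr _ (f0
  n.+1)); first by rewrite inE.
apply: (@has_maximal_indep_step _ _ tailed_cycle_sym tailed_cycle_irr _ (f0 1)).
  rewrite in_setD in_setU1 in_setT in_set -val_eqE /= /tailed_cycle /tailed_cycle_arc
    !inordK; lia.
rewrite (_ : _ :\: _ = seg f0 3 n :|: seg f0 n.+3 N); last first.
  apply/setP => v; rewrite in_setU !sE; try lia.
  rewrite !in_setD !in_setU1 in_setT !in_set -!val_eqE /= /tailed_cycle
    /tailed_cycle_arc !inordK; try lia.
  by have := ltn_ord v; lia.
apply: (has_maximal_indepU tailed_cycle_sym); last 2 first.
- by apply: seg_maximal_indep; lia.
- by rewrite (_ : m - 3 = N - n.+3); [apply: seg_maximal_indep; lia | lia].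
apply: separatedI => u v; rewrite !sE; try lia.
by rewrite -val_eqE /= /tailed_cycle /tailed_cycle_arc; lia.
Qed.

(** The set y_2, y_5, ..., y_(m-1). It avoids y_1, hence leaves the cycle
untouched. *)
Lemma tail_maximal_indep : m %% 3 = 0 -> exists Y, [/\
  maximal_indep e (seg f0 n N) Y, f0 n \notin Y \/ m = 0 & #|Y| = m %/ 3].
Proof.
move=> m3; have [m0|m0] := posnP m.
  rewrite seg_nil; last by lia.
  have [Y mY cY] := has_maximal_indep0 e; exists Y; split=> //; first by right.
  by rewrite cY m0.
have [Y mY cY] := @seg_maximal_indep n.+3 N (leqnn _) (ltac:(lia)).
exists (f0 n.+1 |: Y).
have segE : seg f0 n N :\: (f0 n.+1 |: nbr e (f0 n.+1)) = seg f0 n.+3 N.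
  apply/setP => v; rewrite in_setD !sE; try lia.
  rewrite in_setU1 in_set -val_eqE /= /tailed_cycle /tailed_cycle_arc !inordK; try lia.
have Ysub : forall v, v \in Y -> n.+3 <= v.
  by case: mY => /subsetP YS _ _ v /YS; rewrite sE //; lia.
split.
- apply: (maximal_indep1 tailed_cycle_sym tailed_cycle_irr); last by rewrite segE.
  by rewrite sE // inordK; lia.
- left; rewrite in_setU1 -val_eqE /= !inordK; try lia.
  by rewrite negb_or; apply/andP; split; [lia | apply/negP => /Ysub; rewrite inordK;
    lia].
- rewrite cardsU1 cY; case: (boolP (_ \in Y)) => [/Ysub|_]; first by rewrite inordK;
  lia.
  by rewrite ceil_div3; lia.
Qed.

End TailedCycle.

(** * The class of a cycle of length 3k+1 *)

Section CycleClass.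
Local Open Scope ring_scope.
Variables (F : fieldType) (k m N' : nat).
Local Notation n := (3 * k).+1.
Local Notation N := N'.+1.
Hypotheses (hk : (0 < k)%N) (hN : N = (n + m)%N).
Local Notation e := (@tailed_cycle n N).
Local Notation f0 := (@inord N').
Variable Y : {set 'I_N}.
Hypotheses (mY : maximal_indep e (seg f0 n N) Y) (y1Y : f0 n \notin Y \/ m = 0%N).
Implicit Types (A B : {set 'I_N}) (u v w : 'I_N).

Lemma tail_gtn v : v \in Y -> (n < v)%N.
Proof.
case: mY => /subsetP YS _ _ vY; have := YS v vY;
  rewrite mem_seg_inord // => /andP[nv _].
case: y1Y => [nY|m0]; last by have := ltn_ord v; lia.
rewrite ltn_neqAle nv andbT; apply: contra nY => /eqP ->.
by rewrite inord_val.
Qed.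

(** The j-th stair consists of 0, 3, ..., 3(j-1) followed by 3j+2, ..., 3k-1: the
set 2, 5, ..., 3k-1 with its first j elements decreased by two. Consecutive
stairs differ by one such move. *)
Definition in_stair (j v : nat) :=
  (v < 3 * j)%N && (v %% 3 == 0)%N || (3 * j <= v < 3 * k)%N && (v %% 3 == 2)%N.

Lemma in_stair0 j q : in_stair j (3 * q)%N = (q < j)%N.
Proof. by rewrite /in_stair; lia. Qed.

Lemma in_stair2 j q : in_stair j (3 * q)%N.+2 = (j <= q < k)%N.
Proof. by rewrite /in_stair; lia. Qed.

Definition stair j : {set 'I_N} := [set v : 'I_N | in_stair j v].

Lemma in_stair1 j q : in_stair j (3 * q)%N.+1 = false.
Proof. by rewrite /in_stair; lia. Qed.

Lemma in_stairS (i u : nat) : (i < k)%N ->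
  in_stair i.+1 u || (u == (3 * i).+2)%N = in_stair i u || (u == 3 * i)%N.
Proof.
move=> ik; have [q [r [-> r3]]] : exists q r, (u = 3 * q + r /\ r < 3)%N.
  by exists (u %/ 3)%N, (u %% 3)%N; lia.
case: r r3 => [|[|[|//]]] _; rewrite ?addn0 ?addn1 ?addn2.
- by rewrite !in_stair0; lia.
- by rewrite !in_stair1; lia.
- by rewrite !in_stair2; lia.
Qed.

(** The union of the stairs i and i+1, enlarged by Y. *)
Definition stair_join i : {set 'I_N} :=
  [set v : 'I_N | in_stair i v || (v == 3 * i :> nat)%N] :|: Y.

(** All the stairs enter with the same coefficient: the two stairs contained in
[stair_join] arise by removing elements in consecutive positions, hence with
opposite signs in the coboundary. *)
Definition stair_phi A : F := [exists j : 'I_k.+1, A == stair j :|: Y]%:R.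

Lemma stair_phiP A : stair_phi A != 0 -> exists2 j, (j <= k)%N & A = stair j :|: Y.
Proof.
rewrite /stair_phi; case: existsP => [[j /eqP ->] _|_]; last by rewrite eqxx.
by exists j => //; rewrite -ltnS.
Qed.

Lemma stair_phi1 j : (j <= k)%N -> stair_phi (stair j :|: Y) = 1.
Proof.
rewrite -ltnS => jk; rewrite /stair_phi; case: existsP => // -[].
by exists (Ordinal jk).
Qed.

(** Every vertex of the cycle outside the j-th stair has a neighbour in it, except
possibly 3j-1 and 3j, which lie in its longest gap. Adding one of these gives
the union with the previous or the next stair; the vertices of the tail are
dominated by Y. *)
Lemma stair_add A v : Y \subset A -> indep e A -> v \in A :\: Y ->
  stair_phi (A :\ v) != 0 ->
  exists i, [/\ (i < k)%N, A = stair_join i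
    & (v = 3 * i :> nat \/ v = (3 * i).+2 :> nat)%N].
Proof.
move=> YA /indepP iA; rewrite in_setD => /andP[vY vA] /stair_phiP[j jk AE].
have AE' : A = v |: (stair j :|: Y) by rewrite -AE setD1K.
have vn : (v < n)%N.
  rewrite ltnNge; apply/negP => nv; case: mY => _ _ /(_ v) [|//|w wY evw].
    by rewrite mem_seg_inord // nv ltn_ord.
  by have := iA v w vA (subsetP YA _ wY); rewrite evw.
have vS : v \notin stair j.
  have : v \notin A :\ v by rewrite !inE eqxx.
  by rewrite AE inE => /norP[].
have nbS (w : nat) : (w < n)%N -> tailed_cycle_arc n v w || tailed_cycle_arc n w v ->
    ~~ in_stair j w.
  move=> wn; apply: contraTN => wS; have wA : f0 w \in A.
    by rewrite AE' !in_setU inE [_ \in stair j]inE inordK ?wS ?orbT //; lia.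
  by have := iA v (f0 w) vA wA; rewrite /tailed_cycle inordK //; lia.
have succ_notin (w : nat) : v.+1 = w -> (w < n)%N -> ~~ in_stair j w.
  by move=> vw wn; apply: nbS; rewrite // /tailed_cycle_arc vw eqxx (ltn_eqF wn).
have pred_notin (w : nat) : w.+1 = v -> ~~ in_stair j w.
  move=> wv; apply: nbS; first by lia.
  by rewrite /tailed_cycle_arc -wv eqxx (_ : w.+1 != n) ?orbT //; lia.
have wrap_notin : v = (3 * k)%N :> nat -> ~~ in_stair j (3 * 0)%N.
  by move=> vk; apply: nbS => //; rewrite /tailed_cycle_arc vk !eqxx !orbT.
have [q [r [vqr r3]]] : exists q r, (v = 3 * q + r :> nat /\ r < 3)%N.
  by exists (v %/ 3)%N, (v %% 3)%N; lia.
have vE : (v = 3 * j :> nat /\ j < k \/ v.+1 = 3 * j :> nat /\ 0 < j)%N.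
  move: vS; rewrite inE.
  case: r r3 vqr => [|[|[|//]]] _ vqr.
  - rewrite vqr addn0 in_stair0 -leqNgt leq_eqVlt => /orP[/eqP jq|jq].
      left; split; first by lia.
      rewrite ltn_neqAle jk andbT; apply/negP => /eqP jkE.
      by move: wrap_notin; rewrite in_stair0; lia.
    by have := pred_notin (3 * q.-1)%N.+2; rewrite in_stair2; lia.
  - move=> _; have := pred_notin (3 * q)%N; have := succ_notin (3 * q)%N.+2.
    by rewrite in_stair0 in_stair2; lia.
  - rewrite vqr addn2 in_stair2 => qj.
    have := succ_notin (3 * q.+1)%N; rewrite in_stair0; lia.
have AE2 u : u \in A = (u == v) || in_stair j u || (u \in Y).
  by rewrite AE' !in_setU in_set1 [_ \in stair j]inE orbA.
case: vE => -[vE jlt].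
  exists j; split=> //; last by left.
  apply/setP => u; rewrite AE2 in_setU [u \in [set _ | _]]inE -val_eqE /= vE.
  by rewrite [X in X || _]orbC.
exists j.-1; split; [lia | | right; lia].
apply/setP => u; rewrite AE2 in_setU [u \in [set _ | _]]inE -in_stairS; last by lia.
rewrite prednK // [(u == v) || _]orbC -val_eqE /=.
by rewrite (_ : (3 * j.-1)%N.+2 = v); last by lia.
Qed.

Lemma stair_rem (j w : nat) : (w < n)%N -> ~~ in_stair j w ->
  ([set v : 'I_N | in_stair j v || (v == w :> nat)] :|: Y) :\ f0 w = stair j :|: Y.
Proof.
move=> wn wj; apply/setP => u; rewrite !in_setD1 !in_setU -val_eqE /= inordK;
  last by lia.
rewrite [u \in [set _ | _]]inE [u \in stair j]inE.
have [uw|uw] /= := eqVneq (u : nat) w; last by rewrite orbF.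
rewrite uw (negPf wj) /=; symmetry; apply/negbTE/negP => /tail_gtn; lia.
Qed.

Lemma stair_join_rem0 i : (i < k)%N -> stair_join i :\ f0 (3 * i)%N = stair i :|: Y.
Proof. by move=> ik; apply: stair_rem; rewrite ?in_stair0; lia. Qed.

Lemma stair_join_rem2 i : (i < k)%N ->
  stair_join i :\ f0 (3 * i)%N.+2 = stair i.+1 :|: Y.
Proof.
move=> ik; rewrite -(@stair_rem i.+1 (3 * i)%N.+2) ?in_stair2; [|lia|lia].
congr ((_ :|: Y) :\ _); apply/setP => u; rewrite [LHS]inE [RHS]inE.
by rewrite in_stairS.
Qed.

Lemma stair_join0 i j : (i < k)%N -> (j <= k)%N ->
  (f0 (3 * j)%N \in stair_join i) = (j <= i)%N.
Proof.
move=> ik jk; have jE : f0 (3 * j)%N = (3 * j)%N :> nat by rewrite inordK; lia.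
rewrite in_setU inE jE in_stair0.
case: (boolP (_ \in Y)) => [/tail_gtn|_]; first by rewrite jE; lia.
by lia.
Qed.

Lemma stair_join_inj i j : (i < k)%N -> (j < k)%N -> stair_join i = stair_join j ->
  i = j.
Proof.
move=> ik jk E; apply/eqP; rewrite eqn_leq.
rewrite -(stair_join0 jk (ltnW ik)) -E stair_join0 ?leqnn //=; last exact: ltnW.
by rewrite -(stair_join0 ik (ltnW jk)) E stair_join0 ?leqnn // ltnW.
Qed.

Lemma stair_join_pos i : (i < k)%N ->
  ord_pos (f0 (3 * i)%N.+2) (stair_join i) = (ord_pos (f0 (3 * i)%N) (stair_join i)).+1.
Proof.
move=> ik; have fE (w : nat) : (w < n)%N -> f0 w = w :> nat.
  by move=> wn; rewrite inordK //; lia.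
have aE : f0 (3 * i)%N = (3 * i)%N :> nat by apply: fE; lia.
have bE : f0 (3 * i)%N.+2 = (3 * i)%N.+2 :> nat by apply: fE; lia.
have key (x : nat) : (x != 3 * i)%N && ((in_stair i x || (x == 3 * i)%N) && (x < (3 *
  i).+2)%N)
    = (in_stair i x || (x == 3 * i)%N) && (x < 3 * i)%N.
  case: (ltngtP x (3 * i)%N) => xi; rewrite ?andbF ?orbF ?andbT //=.
    by rewrite (ltn_trans xi) ?andbT.
  have [->|ne] := eqVneq x (3 * i)%N.+1; first by rewrite in_stair1.
  by rewrite [(x < _)%N]ltnNge ltn_neqAle eq_sym ne xi andbF.
rewrite /ord_pos [LHS](cardsD1 (f0 (3 * i)%N)) inE stair_join0 // ?leqnn;
  last exact: ltnW.
rewrite aE bE ltnS leqnSn add1n; congr _.+1; apply: eq_card => u.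
rewrite !inE -val_eqE /= aE.
have [/tail_gtn uY|uY] := boolP (u \in Y); last by rewrite !orbF key.
have u3 : (3 * i < u)%N by lia.
by rewrite orbT /= [in RHS]ltnNge (ltnW u3) /= ltnNge -ltnS; case: (_ != _) => //=; lia.
Qed.

(** A face with a nonzero term is the union of two consecutive stairs, and then
exactly two terms are nonzero, with opposite signs. *)
Lemma stair_cocycle A : Y \subset A -> indep e A -> cobound Y stair_phi A = 0.
Proof.
move=> YA iA; rewrite /cobound.
have [/existsP[v0 /andP[v0A v0phi]]|] :=
    boolP [exists v, (v \in A :\: Y) && (stair_phi (A :\ v) != 0)]; last first.
  rewrite negb_exists => /forallP none; apply: big1 => v vA.
  by have := none v; rewrite vA /= negbK => /eqP->; rewrite mulr0.
have [i [ik AE _]] := stair_add YA iA v0A v0phi.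
have fE (w : nat) : (w < n)%N -> f0 w = w :> nat by move=> wn; rewrite inordK //; lia.
have inA (w : nat) : (w < n)%N -> in_stair i w || (w == 3 * i)%N -> f0 w \in A :\: Y.
  move=> wn wS; rewrite in_setD AE in_setU inE fE // wS andbT.
  by apply/negP => /tail_gtn; rewrite fE //; lia.
have aA : f0 (3 * i)%N \in A :\: Y by apply: inA; rewrite ?eqxx ?orbT //; lia.
have bA : f0 (3 * i)%N.+2 \in A :\: Y by apply: inA; rewrite ?in_stair2; lia.
have ab : f0 (3 * i)%N.+2 != f0 (3 * i)%N by rewrite -val_eqE /= !fE; lia.
rewrite (bigD1 _ aA) (bigD1 (f0 (3 * i)%N.+2)) /=; last exact/andP.
rewrite big1 ?addr0 => [|v /andP[/andP[vA va] vb]]; last first.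
  have [->|/(stair_add YA iA vA)[i' [ik' AE' vE]]] := eqVneq (stair_phi (A :\ v)) 0.
    by rewrite mulr0.
  have ii' : i = i' by apply: stair_join_inj; rewrite // -AE -AE'.
  case: vE; rewrite -ii' => vE; [case/eqP: va | case/eqP: vb];
    by apply: val_inj; rewrite /= -vE inord_val.
have := stair_phi1 (ltnW ik); have := stair_phi1 ik.
rewrite -stair_join_rem2 // -stair_join_rem0 // -AE => -> ->.
have := stair_join_pos ik; rewrite -AE => ->.
by rewrite exprS; ring.
Qed.

Implicit Types (s : {ffun 'I_k -> bool}) (i l : 'I_k).

(** The vertices 3i+1 and 3i+2 of the cycle are the poles of the i-th axis of a
cross-polytope; the vertices 3i separate the axes. *)
Definition pole s i : 'I_N := f0 (3 * i + s i)%N.+1.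

Definition cross_facet s : {set 'I_N} := pole s @: [set: 'I_k] :|: Y.

Definition cross_sign s : F := \prod_i (-1) ^+ s i.

Lemma poleE s i : pole s i = (3 * i + s i)%N.+1 :> nat.
Proof. by rewrite inordK //; have := ltn_ord i; case: (s i); lia. Qed.

Lemma pole_ltn s i : (pole s i < n)%N.
Proof. by rewrite poleE; have := ltn_ord i; case: (s i); lia. Qed.

Lemma pole_inj s : injective (pole s).
Proof.
move=> i l /(congr1 val); rewrite /= !poleE => E; apply: val_inj => /=.
by move: E; case: (s i); case: (s l); lia.
Qed.

Lemma pole_notin s i : pole s i \notin Y.
Proof. by apply/negP => /tail_gtn; have := pole_ltn s i; lia. Qed.

Lemma cross_facetD s : cross_facet s :\: Y = pole s @: [set: 'I_k].
Proof.
apply/setP => v; rewrite in_setD in_setU andb_orr andNb orbF andb_idl //.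
by case/imsetP => i _ ->; apply: pole_notin.
Qed.

Lemma cross_facet_indep s : indep e (cross_facet s).
Proof.
apply/indepP => u v; rewrite !in_setU.
have iY : indep e Y by case: mY.
have iP i l : ~~ e (pole s i) (pole s l).
  have [->|] := eqVneq i l; first by rewrite /tailed_cycle /tailed_cycle_arc; lia.
  rewrite /tailed_cycle /tailed_cycle_arc !poleE -val_eqE /=.
  by have := ltn_ord i; have := ltn_ord l; case: (s i); case: (s l); lia.
have iPY i w : w \in Y -> ~~ e (pole s i) w.
  by move=> /tail_gtn wY; have := pole_ltn s i;
    rewrite /tailed_cycle /tailed_cycle_arc; lia.
case/orP => [/imsetP[i _ ->]|uY] /orP[/imsetP[l _ ->]|vY].
- exact: iP.
- exact: iPY.
- by rewrite tailed_cycle_sym iPY.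
- by move/indepP: iY; apply.
Qed.

Lemma card_cross_facet s : #|cross_facet s| = (k + #|Y|)%N.
Proof.
rewrite -(cardsID Y) cross_facetD card_imset ?cardsT ?card_ord; last exact: pole_inj.
by rewrite addnC; congr (_ + #|pred_of_set _|)%N; apply/setIidPr/subsetUr.
Qed.

Definition antipode i s : {ffun 'I_k -> bool} :=
  [ffun l => if l == i then ~~ s l else s l].

Lemma antipodeK i : involutive (antipode i).
Proof. by move=> s; apply/ffunP => l; rewrite !ffunE; case: eqP; rewrite ?negbK. Qed.

Lemma cross_facet_rem s i :
  cross_facet s :\ pole s i = [set pole s l | l in [set~ i]] :|: Y.
Proof.
apply/setP => v; rewrite in_setD1 !in_setU.
have [->|vi] /= := eqVneq v (pole s i).
  rewrite (negPf (pole_notin s i)) orbF; symmetry; apply/negbTE/negP.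
  by case/imsetP => l; rewrite !inE => li /pole_inj E; rewrite E eqxx in li.
congr (_ || _); apply/imsetP/imsetP => -[l lA vE]; exists l => //; rewrite !inE //.
by apply: contraNneq vi => li; rewrite vE li.
Qed.

Lemma cross_facet_rem_antipode s i :
  cross_facet (antipode i s) :\ pole (antipode i s) i = cross_facet s :\ pole s i.
Proof.
rewrite !cross_facet_rem; congr (_ :|: _); apply: eq_in_imset => l.
by rewrite !inE /pole ffunE => /negPf->.
Qed.

Lemma cross_facet_pos s i : ord_pos (pole s i) (cross_facet s) =
  #|[set u in cross_facet s :\ pole s i | (u < (3 * i).+1)%N]|.
Proof.
rewrite (ord_posD1 _ (pole s i)) ltnn andbF add0n.
apply: eq_card => u; rewrite [LHS]in_set [RHS]in_set.
have [|//] := boolP (u \in cross_facet s :\ pole s i).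
rewrite cross_facet_rem in_setU => /orP[/imsetP[l]|uY].
  rewrite !inE -val_eqE /= => li ->; rewrite !poleE.
  by case: (s i); case: (s l); lia.
by have := tail_gtn uY; have := pole_ltn s i; have := ltn_ord i; lia.
Qed.

Lemma cross_sign_antipode s i : cross_sign (antipode i s) = - cross_sign s.
Proof.
rewrite /cross_sign (bigD1 i) //= [in RHS](bigD1 i) //= ffunE eqxx.
rewrite (eq_bigr (fun l => (-1) ^+ s l)) => [|l /negPf li]; last by rewrite ffunE li.
by case: (s i); rewrite /= ?expr0 ?expr1 ?mulN1r ?mul1r ?opprK.
Qed.

(** Along each axis, exchanging the poles changes the sign and preserves the
face with that pole removed as well as the position of the pole. *)
Lemma cross_cycle (psi : {set 'I_N} -> F) :
  \sum_s cross_sign s * cobound Y psi (cross_facet s) = 0.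
Proof.
pose G i s := cross_sign s * ((-1) ^+ ord_pos (pole s i) (cross_facet s) * psi
  (cross_facet s :\ pole s i)).
transitivity (\sum_s \sum_i G i s).
  apply: eq_bigr => s _; rewrite /cobound cross_facetD big_imset /=; last first.
    by move=> i l _ _; apply: pole_inj.
  by rewrite mulr_sumr; apply: eq_bigl => i; rewrite inE.
rewrite exchange_big big1 //= => i _.
have GN s : G i (antipode i s) = - G i s.
  by rewrite /G cross_sign_antipode !cross_facet_pos cross_facet_rem_antipode mulNr.
rewrite (bigID (fun s : {ffun 'I_k -> bool} => s i)) /=.
rewrite [X in _ + X](reindex_inj (inv_inj (antipodeK i))) /=.
rewrite [X in _ + X](eq_big (fun s : {ffun 'I_k -> bool} => s i) (fun s => - G i s)).
- by rewrite sumrN subrr.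
- by move=> s; rewrite ffunE eqxx negbK.
- by move=> s _; rewrite GN.
Qed.

(** For j > 0 the j-th stair contains the vertex 0, which is not a pole. *)
Lemma stair_cross_facet s j : cross_facet s = stair j :|: Y -> (j <= k)%N ->
  j = 0%N /\ forall i, s i.
Proof.
move=> E jk; have j0 : j = 0%N.
  apply/eqP; rewrite -leqn0 leqNgt; apply/negP => jpos.
  have : f0 (3 * 0)%N \in cross_facet s.
    by rewrite E !inE inordK // in_stair0 jpos.
  rewrite in_setU => /orP[/imsetP[l _]|/tail_gtn]; last by rewrite inordK.
  by move/(congr1 (@nat_of_ord _)); rewrite poleE inordK.
split=> // i; have : pole s i \in cross_facet s by rewrite in_setU imset_f.
rewrite E in_setU (negPf (pole_notin s i)) orbF inE poleE.
by case: (s i) => //; rewrite addn0 in_stair1.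
Qed.

Lemma stair0E : stair 0 :|: Y = cross_facet [ffun=> true].
Proof.
congr (_ :|: Y); apply/setP => v; rewrite inE; apply/idP/imsetP.
  move=> vS; have [q [r [vE r3]]] : exists q r, (v = 3 * q + r :> nat /\ r < 3)%N.
    by exists (v %/ 3)%N, (v %% 3)%N; lia.
  move: vS; rewrite vE; case: r r3 vE => [|[|[|//]]] _;
    rewrite ?addn0 ?addn1 ?addn2 => vE.
  - by rewrite in_stair0.
  - by rewrite in_stair1.
  - rewrite in_stair2 => /andP[_ qk]; exists (Ordinal qk); rewrite ?inE //.
    by apply: ord_inj; rewrite poleE ffunE /= vE addn1.
case=> l _ ->; rewrite poleE ffunE /= addn1 in_stair2.
exact: ltn_ord.
Qed.

Lemma stair_cross_pair : \sum_s cross_sign s * stair_phi (cross_facet s) != 0.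
Proof.
rewrite (bigD1 [ffun=> true]) //= big1 ?addr0 => [|s nt]; last first.
  have [->|/stair_phiP[j jk E]] := eqVneq (stair_phi (cross_facet s)) 0;
    first by rewrite mulr0.
  have [_ st] := stair_cross_facet E jk.
  by case/eqP: nt; apply/ffunP => i; rewrite ffunE st.
rewrite -stair0E stair_phi1 // mulr1 /cross_sign.
by apply/prodf_neq0 => i _; apply: expf_neq0; rewrite oppr_eq0 oner_eq0.
Qed.

Theorem cycle_class : indep_class F e Y (k + #|Y|).
Proof.
apply: (@IndepClass F _ e Y (k + #|Y|) stair_phi {ffun 'I_k ->
  bool} cross_sign cross_facet).
- by move=> A /stair_phiP[j _ ->]; apply: subsetUr.
- by move=> A YA iA _; apply: stair_cocycle.
- by move=> s; rewrite subsetUr cross_facet_indep card_cross_facet.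
- exact: cross_cycle.
- exact: stair_cross_pair.
Qed.


End CycleClass.

(** * The depth formula *)

(** For m divisible by three, (m+1) %/ 3 is m %/ 3. *)
Definition tailed_cycle_depth_value n m :=
  if m %% 3 == 1 then ceil_div n 3 + (m - 1) %/ 3
  else ceil_div (n - 1) 3 + (m + 1) %/ 3.

Lemma has_maximal_indep_class (k : fieldType) N (e : rel 'I_N) d : has_maximal_indep e
  [set: 'I_N] d ->
  exists Y, indep_class k e Y d.
Proof. by case=> Y mY <-; exists Y; apply: maximal_indep_class. Qed.

Lemma tailed_cycle_class (k : fieldType) n m N' : 3 <= n -> N'.+1 = n + m ->
  exists Y, indep_class k (@tailed_cycle n N'.+1) Y (tailed_cycle_depth_value n m).
Proof.
move=> hn hN; rewrite /tailed_cycle_depth_value.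
have [m1|m1] := eqVneq (m %% 3) 1.
  have := tailed_cycle_maximal_indep_x2 hn hN;
    rewrite (_ : _ + _ + _ = ceil_div n 3 + (m - 1) %/ 3).
    exact: has_maximal_indep_class.
  by rewrite !ceil_div3; lia.
have [m2|m2] := eqVneq (m %% 3) 2.
  have := tailed_cycle_maximal_indep_y1 hn hN;
    rewrite (_ : _ + _ + _ = ceil_div (n - 1) 3 + (m + 1) %/ 3).
    by move=> H; apply/has_maximal_indep_class/H; lia.
  by rewrite !ceil_div3; lia.
have m0 : m %% 3 = 0 by lia.
have [n1|n1] := eqVneq (n %% 3) 1; last first.
  have [mE|mpos] := posnP m.
    have := tailed_cycle_maximal_indep_x2 hn hN;
      rewrite (_ : _ + _ + _ = ceil_div (n - 1) 3 + (m + 1) %/ 3).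
      exact: has_maximal_indep_class.
    by rewrite !ceil_div3; lia.
  have := tailed_cycle_maximal_indep_y2 hn hN;
    rewrite (_ : _ + _ + _ = ceil_div (n - 1) 3 + (m + 1) %/ 3).
    by move=> H; apply/has_maximal_indep_class/H; lia.
  by rewrite !ceil_div3; lia.
have [Y [mY y1Y cY]] := tail_maximal_indep hn hN m0.
have [q nE] : exists q, n = (3 * q).+1 by exists (n %/ 3); lia.
subst n; exists Y; rewrite (_ : _ + _ = q + #|Y|); last by rewrite cY ceil_div3; lia.
by apply: (cycle_class k _ hN mY y1Y); lia.
Qed.

(** The vertex set is 'I_N with N = n + m up to a propositional equality only, so
that the case m = 0 applies to the cycle itself, whose ring has n variables. *)
Lemma tailed_cycle_depth (k : fieldType) n m N (s : seq {mpoly k[N]}) :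
  3 <= n -> N = n + m -> edge_gens (@tailed_cycle n N) s ->
  depth (max_ideal k N) s = tailed_cycle_depth_value n m.
Proof.
case: N s => [|N'] s hn hN sE; first by lia.
have [Y cls] := tailed_cycle_class k hn hN.
apply: (edge_depth (@tailed_cycle_sym n N') _ sE _ cls);
  first exact: tailed_cycle_irr hn hN.
apply: (tailed_cycle_branch_bound hn hN); rewrite /tailed_cycle_depth_value;
  case: eqP => m1;
  rewrite !ceil_div3; lia.
Qed.

Lemma cycle_edge_gens (k : fieldType) n : 3 <= n ->
  edge_gens (@tailed_cycle n n) (I_C k n).
Proof.
move=> hn; split=> [f /mapP[i _ ->]|u v].
  exists i, (ordS i); split=> //; rewrite /tailed_cycle /tailed_cycle_arc /=.
  have := ltn_ord i; rewrite leq_eqVlt => /orP[/eqP E|lt].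
    by rewrite E modnn; lia.
  by rewrite modn_small //; lia.
have mem (w x : 'I_n) : tailed_cycle_arc n w x -> ('X_w * 'X_x)%R \in I_C k n.
  move=> wx; apply/mapP; exists w; first by rewrite mem_enum.
  congr (_ * 'X_ _)%R; apply: val_inj => /=; move: wx.
  have := ltn_ord x; have := ltn_ord w; rewrite leq_eqVlt /tailed_cycle_arc =>
    /orP[/eqP E|lt].
    by rewrite E modnn; lia.
  by rewrite modn_small //; lia.
by case/orP => /mem; [left | right].
Qed.

Lemma tailed_cycle_edge_gens (k : fieldType) n m : 3 <= n ->
  edge_gens (@tailed_cycle n (n + m)) (I_G k n m).
Proof.
move=> hn; split=> [f|u v].
  rewrite !mem_cat => /or3P[/mapP[i _ ->]|/mapP[[i j]]|/mapP[[i j]]].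
  - exists (lshift m i), (lshift m (ordS i)); split=> //.
    rewrite /tailed_cycle /tailed_cycle_arc /=.
    have := ltn_ord i; rewrite leq_eqVlt => /orP[/eqP E|lt].
      by rewrite E modnn; lia.
    by rewrite modn_small //; lia.
  - rewrite mem_filter /= => /andP[/andP[/eqP i1 /eqP j0] _] ->.
    exists (lshift m i), (rshift n j); split=> //.
    by rewrite /tailed_cycle /tailed_cycle_arc /= i1 j0; lia.
  - rewrite mem_filter /= => /andP[/eqP ij _] ->.
    exists (rshift n i), (rshift n j); split=> //.
    by rewrite /tailed_cycle /tailed_cycle_arc /= ij; lia.
have mem (w x : 'I_(n + m)) : tailed_cycle_arc n w x -> ('X_w * 'X_x)%R \in I_G k n m.
  rewrite /I_G !mem_cat -(splitK w) -(splitK x).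
  case: (split w) => i; case: (split x) => j /=; rewrite /tailed_cycle_arc /= => wx.
  - apply/orP; left; apply/mapP; exists i; first by rewrite mem_enum.
    congr (_ * 'X_ _)%R; apply: val_inj => /=; move: wx.
    have := ltn_ord j; have := ltn_ord i; rewrite leq_eqVlt => /orP[/eqP E|lt].
      by rewrite E modnn; lia.
    by rewrite modn_small //; lia.
  - apply/or3P/Or32/mapP; exists (i, j) => //.
    by rewrite mem_filter mem_enum /= andbT; have := ltn_ord i; lia.
  - by have := ltn_ord j; lia.
  - apply/or3P/Or33/mapP; exists (i, j) => //.
    by rewrite mem_filter mem_enum /= andbT; lia.
by case/orP => /mem; [left | right].
Qed.

Theorem theorem3p8 (k : fieldType) (n m : nat) (hn : (3 <= n)%N) :
  let depthC := depth (max_ideal k n) (I_C k n) in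
  let depthG := depth (max_ideal k (n + m)) (I_G k n m) in
  [/\ (m = 0 %[mod 3])%N ->
        (depthG = depthC + m %/ 3)%N /\
        (depthC + m %/ 3 = ceil_div (n - 1) 3 + m %/ 3)%N,
      (m = 1 %[mod 3])%N ->
        (depthG = ceil_div n 3 + (m - 1) %/ 3)%N
    & (m = 2 %[mod 3])%N ->
        (depthG = depthC + (m + 1) %/ 3)%N /\
        (depthC + (m + 1) %/ 3 = ceil_div (n - 1) 3 + (m + 1) %/ 3)%N].
Proof.
move=> depthC depthG.
have dC : depthC = ceil_div (n - 1) 3.
  rewrite /depthC (tailed_cycle_depth hn (esym (addn0 n)) (cycle_edge_gens k hn)).
  by rewrite /tailed_cycle_depth_value mod0n /= add0n divn_small ?addn0.
have dG : depthG = tailed_cycle_depth_value n m.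
  exact: (tailed_cycle_depth hn erefl (tailed_cycle_edge_gens k m hn)).
split=> m3; rewrite dG ?dC /tailed_cycle_depth_value; case: eqP; lia.
Qed.
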